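(* Let $\mathcal{F}=\mathbb{F}_q(x,y)$ be a cubic extension of $\mathbb{F}_q(x)$ given by $y^3=B(x)$, where $B(x)\in\mathbb{F}_q[x]$ is squarefree and factors into $r$ distinct irreducible polynomials. Assume that $3$ divides neither $\deg(B)$ nor the characteristic of $\mathbb{F}_q$, and that $r\ge 2$. Then $3^{r-1}\mid h$, where $h$ is the class number of $\mathcal{F}$.
   Context: $\mathbb{F}_q$ is the finite field with $q$ elements and $x$ is transcendental over it. The class number $h$ is the divisor class number, i.e. the order of the group of degree-$0$ divisors of $\mathcal{F}/\mathbb{F}_q$ modulo principal divisors. *)

(* Defs.v *)
From HB Require Import structures.
From mathcomp Require Import all_boot all_order all_algebra all_field.
From mathcomp Require Import generic_quotient fraction.
From mathcomp Require Import boolp classical_sets functions cardinality.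
From mathcomp.multinomials Require Import freeg.

Set Implicit Arguments.
Unset Strict Implicit.
Unset Printing Implicit Defensive.

Import Order.TTheory GRing.Theory Num.Theory.
Local Open Scope ring_scope.

Definition squarefree_poly (K : fieldType) (p : {poly K}) : Prop :=
  forall u : {poly K}, size u != 1%N -> ~~ (u ^+ 2 %| p).

(* Algebraic function fields over K are given as finite extensions L of the
   rational function field K(x) = {fraction {poly K}}, with x the image of 'X. *)
Section FunctionField.
Variables (K : fieldType) (L : fieldExtType {fraction {poly K}}).

Definition of_poly (p : {poly K}) : L := (tofrac p)%:A.

Definition of_const (c : K) : L := of_poly c%:P.

(* A place of L / K is represented by its normalized discrete valuation. The
   value +oo at 0 is replaced by 0, so that a place determines its function
   and distinct functions are distinct places. *)
Record place := Place {
  place_val :> L -> int;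
  place_val0 : place_val 0 = 0;
  place_valM : forall f g, f != 0 -> g != 0 ->
    place_val (f * g) = place_val f + place_val g;
  place_valD : forall f g, f != 0 -> g != 0 -> f + g != 0 ->
    Order.min (place_val f) (place_val g) <= place_val (f + g);
  place_val_const : forall c : K, place_val (of_const c) = 0;
  place_val_unif : exists t, place_val t = 1 }.

HB.instance Definition _ := gen_eqMixin place.
HB.instance Definition _ := gen_choiceMixin place.

(* As P 0 = 0, the first predicate holds at 0, but the second one needs a
   separate clause. *)
Definition in_valuation_ring (P : place) (f : L) : bool := 0 <= P f.

Definition in_maximal_ideal (P : place) (f : L) : bool := (f == 0) || (0 < P f).

(* The residue classes of the b i form a K-basis of O_P / M_P. *)
Definition residue_basis (P : place) (n : nat) (b : 'I_n -> L) : Prop :=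
  (forall i, in_valuation_ring P (b i)) /\
  (forall f, in_valuation_ring P f ->
    exists! a : 'rV[K]_n,
      in_maximal_ideal P (f - \sum_(i < n) of_const (a 0 i) * b i)).

Definition place_degree (P : place) : nat :=
  xget 0%N [set n | exists b : 'I_n -> L, residue_basis P b]%classic.

Definition divisor := {freeg place}.

(* freeg.deg gives weight 1 to every generator, hence the explicit lift. *)
Definition divisor_degree (D : divisor) : int :=
  fglift (fun P => (place_degree P)%:Z : int^o) D.

Definition principal (D : divisor) : Prop :=
  exists2 f : L, f != 0 & forall P : place, coeff P D = P f.

Definition divisor_class (D : divisor) : set divisor :=
  [set E | principal (E - D)]%classic.

Definition class_group0 : set (set divisor) :=
  (divisor_class @` [set D | divisor_degree D = 0])%classic.

Definition is_class_number (h : nat) : Prop :=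
  (class_group0 #= `I_h)%card.

End FunctionField.

(* Main.v *)
Require Import Defs.
From HB Require Import structures.
From mathcomp Require Import all_boot all_order all_algebra all_field.
From mathcomp Require Import generic_quotient fraction.
From mathcomp Require Import boolp classical_sets cardinality.
From mathcomp.multinomials Require Import freeg.
From mathcomp Require Import zify ring.

(** Let [P i] be the place of [L] above [Q i] and [Pinf] the one above infinity.
    The values of [B = y ^ 3] at the corresponding places of [K(x)] are 1 and
    [- deg B], both prime to 3, and so these places are totally ramified. Hence
    the divisor of [Q i] is [3 * D i], where [D i = P i - deg (Q i) * Pinf] has
    degree 0.

    Suppose that the sum of the [a i * D i] is the divisor of some [f]. Then
    [f ^ 3] and the product of the [Q i ^ a i] have the same divisor, hence
    differ by a constant ([constant_of_places]). An element of [L] with cube in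
    [K(x)] is a monomial [g y ^ l] with [g] in [K(x)] ([cubic_cube_coord]), so
    its value at each [P i] is [l] modulo 3, that is, all the [a i] are
    congruent modulo 3 ([ramified_divisors]). So the classes of all the [D i]
    but one generate a group isomorphic to [(Z/3)^(r-1)], and
    Lagrange's theorem concludes ([dvdn_card_quotient]).

    It remains to have enough places for [constant_of_places]. Subtracting the
    residue at infinity, it is enough that an element of [L] with no pole
    outside infinity has polynomial coordinates on [1, y, y ^ 2]
    ([cubic_int_of_places]): such an element has value at most 0 at infinity,
    unless it is 0. If an irreducible [Q] occurs in the common denominator of
    the coordinates, then a pole is found as follows. For [Q] dividing [B], it
    is the ramified place. Otherwise the order [K[x][y]] is reduced modulo [Q],
    since the characteristic is not 3 ([cubic_square_coord]); so for any [G] of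
    [K[x][y]] not divisible by [Q] there is a prime ideal which contains [Q]
    but not [G], and whose localization is a discrete valuation ring with
    uniformizer [Q] ([unramified_place]). The places above polynomials all come
    from one criterion ([place_of_prime]); the infinite place is given by the
    degree of the norm ([infinite_place]). *)

Set Implicit Arguments.
Unset Strict Implicit.
Unset Printing Implicit Defensive.

Import Order.TTheory GRing.Theory Num.Theory.
Local Open Scope ring_scope.

(** * Polynomials as elements, and places as valuations *)

Section Embedding.
Variables (K : fieldType) (L : fieldExtType {fraction {poly K}}).

Fact of_poly_is_zmod_morphism : zmod_morphism (of_poly L).
Proof. by move=> p q; rewrite /of_poly tofracB scalerBl. Qed.

Fact of_poly_is_monoid_morphism : monoid_morphism (of_poly L).
Proof.
split=> [|p q]; first by rewrite /of_poly tofrac1 scale1r.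
by rewrite /of_poly tofracM -scalerAl mul1r scalerA.
Qed.

HB.instance Definition _ :=
  GRing.isZmodMorphism.Build {poly K} L (of_poly L) of_poly_is_zmod_morphism.
HB.instance Definition _ :=
  GRing.isMonoidMorphism.Build {poly K} L (of_poly L)
    of_poly_is_monoid_morphism.

Lemma of_poly_eq0 p : (of_poly L p == 0) = (p == 0).
Proof. by rewrite /of_poly scaler_eq0 oner_eq0 orbF tofrac_eq0. Qed.

End Embedding.

Section Place.
Variables (K : fieldType) (L : fieldExtType {fraction {poly K}}).
Implicit Types (P : place L) (f g : L) (n m : int).

Lemma place_val1 P : P 1 = 0.
Proof.
have H : P (1 * 1) = P 1 + P 1 by apply: place_valM; exact: oner_neq0.
by rewrite mulr1 in H; lia.
Qed.

Lemma place_valV P f : P f^-1 = - P f.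
Proof.
have [->|f0] := eqVneq f 0; first by rewrite invr0 place_val0.
have := place_valM P f0 (invr_neq0 f0); rewrite mulfV // place_val1; lia.
Qed.

Lemma place_valX P f k : P (f ^+ k) = P f * k%:Z.
Proof.
have [->|f0] := eqVneq f 0.
  by rewrite expr0n place_val0 mul0r; case: k => [|k]; rewrite ?place_val1 ?place_val0.
elim: k => [|k IH]; first by rewrite expr0 place_val1 mulr0.
by rewrite exprS place_valM ?expf_neq0 // IH; lia.
Qed.

Lemma place_valN P f : P (- f) = P f.
Proof.
have [->|f0] := eqVneq f 0; first by rewrite oppr0.
rewrite -mulN1r place_valM ?oppr_eq0 ?oner_eq0 //.
by rewrite -(rmorph1 (of_poly L)) -rmorphN -polyC1 -polyCN place_val_const add0r.
Qed.

(** The value of 0 is [+oo] here, whereas a place itself maps 0 to 0; so the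
    sets of the elements of value at least [n] are additive subgroups. *)
Definition vge P n f := (f == 0) || (n <= P f).

Lemma vgeW P n m f : m <= n -> vge P n f -> vge P m f.
Proof. by move=> nm; rewrite /vge => /orP[->//|/(le_trans nm) ->]; rewrite orbT. Qed.

Lemma vge0 P n : vge P n 0. Proof. by rewrite /vge eqxx. Qed.

Lemma vgeP P n f : f != 0 -> vge P n f = (n <= P f).
Proof. by rewrite /vge => /negPf ->. Qed.

Lemma vge_val P f : vge P (P f) f. Proof. by rewrite /vge lexx orbT. Qed.

Lemma vgeD P n f g : vge P n f -> vge P n g -> vge P n (f + g).
Proof.
have [->|f0] := eqVneq f 0; first by rewrite add0r.
have [->|g0] := eqVneq g 0; first by rewrite addr0.
have [->|fg0] := eqVneq (f + g) 0; first by rewrite vge0.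
by rewrite !vgeP // => nf ng; apply: le_trans (place_valD P f0 g0 fg0); rewrite le_min nf.
Qed.

Lemma vgeN P n f : vge P n (- f) = vge P n f.
Proof. by rewrite /vge oppr_eq0 place_valN. Qed.

Lemma vgeB P n f g : vge P n f -> vge P n g -> vge P n (f - g).
Proof. by move=> nf ng; apply: vgeD => //; rewrite vgeN. Qed.

Lemma vgeM P n m f g : vge P n f -> vge P m g -> vge P (n + m) (f * g).
Proof.
have [->|f0] := eqVneq f 0; first by rewrite mul0r !vge0.
have [->|g0] := eqVneq g 0; first by rewrite mulr0 !vge0.
by rewrite !vgeP ?mulf_neq0 // place_valM //; lia.
Qed.

Lemma vge_sum P n (I : Type) (r : seq I) (F : I -> L) :
  (forall i, vge P n (F i)) -> vge P n (\sum_(i <- r) F i).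
Proof. by move=> H; apply: (big_ind (vge P n)) => // [|f g]; [exact: vge0|exact: vgeD]. Qed.

Lemma vge_const P c : vge P 0 (of_const L c).
Proof. by rewrite /vge place_val_const lexx orbT. Qed.

Lemma in_valuation_ringE P f : in_valuation_ring P f = vge P 0 f.
Proof.
by rewrite /in_valuation_ring /vge; have [->|] := eqVneq f 0; rewrite ?place_val0.
Qed.

Lemma in_maximal_idealE P f : in_maximal_ideal P f = vge P 1 f.
Proof. by rewrite /in_maximal_ideal /vge; congr (_ || _); lia. Qed.

Lemma place_val_dominant P f g :
  f != 0 -> vge P (P f + 1) g -> (f + g != 0) /\ P (f + g) = P f.
Proof.
move=> f0 Hg.
have Hn : ~~ vge P (P f + 1) (f + g).
  apply/negP=> H; have := vgeB H Hg; rewrite addrK vgeP //; lia.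
have fg0 : f + g != 0 by apply: contraNneq Hn => ->; exact: vge0.
split=> //; move: Hn; rewrite vgeP // => Hn.
have: vge P (P f) (f + g).
  by apply: vgeD (vge_val _ _) (vgeW _ Hg); lia.
rewrite vgeP //; lia.
Qed.

Lemma place_eqP P P' : (forall f, P f = P' f) -> P = P'.
Proof.
case: P P' => [v a b c d e] [v' a' b' c' d' e'] /= /funext H.
by case: _ / H in a' b' c' d' e' *; congr Place; exact: Prop_irrelevance.
Qed.

(** Two places cannot be proper multiples of each other, because both take the
    value 1. *)
Lemma place_eq_of_scale P P' (e : int) :
  0 < e -> (forall f, f != 0 -> P f = e * P' f) -> P = P'.
Proof.
move=> e0 H; have [t Pt] := place_val_unif P.
have t0 : t != 0 by apply: contra_eqN Pt => /eqP ->; rewrite place_val0.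
have e1 : e = 1.
  have := H _ t0; rewrite Pt => /esym H1.
  have : (e %| 1)%Z by apply/dvdzP; exists (P' t); rewrite mulrC.
  by rewrite dvdz1; lia.
apply: place_eqP => f; have [->|/H ->] := eqVneq f 0; first by rewrite !place_val0.
by rewrite e1 mul1r.
Qed.

End Place.

Section UnitRep.
Variables (K : fieldType) (L : fieldExtType {fraction {poly K}}).

(** [f] is [t ^ n] times a unit of the localization of the ring [R] at its
    prime [M]. *)
Definition unit_rep (R M : L -> Prop) (t f : L) (n : int) : Prop :=
  exists s s', [/\ R s, R s', ~ M s, ~ M s' & f = t ^ n * s / s'].

Variables (R M : L -> Prop) (t psi : L).
Hypotheses (R_const : forall c, R (of_const L c))
  (R_add : forall f g, R f -> R g -> R (f + g))
  (R_mul : forall f g, R f -> R g -> R (f * g))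
  (R_frac : forall f, exists g h, [/\ R g, R h, h != 0 & f = g / h])
  (M_mul : forall f g, R f -> R g -> M f -> M (f * g))
  (M_prime : forall f g, R f -> R g -> M (f * g) -> M f \/ M g)
  (R_t : R t) (M_t : M t) (t_neq0 : t != 0)
  (R_psi : R psi) (M_psi : ~ M psi)
  (M_psiP : forall f, R f -> M f -> R (psi * f / t))
  (R_separated : forall f, R f -> f != 0 -> exists n, ~ R (psi ^+ n * f / t ^+ n)).

Let rep := unit_rep R M t.

Let R0 : R 0.
Proof. by have := R_const 0; rewrite /of_const rmorph0. Qed.

Let R1 : R 1.
Proof. by have := R_const 1; rewrite /of_const rmorph1. Qed.

Let RX f n : R f -> R (f ^+ n).
Proof. by move=> Rf; elim: n => [|n IH]; rewrite ?expr0 ?exprS //; exact: R_mul. Qed.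

Let nM1 : ~ M 1.
Proof. by move=> /M_mul - /(_ psi R1 R_psi); rewrite mul1r. Qed.

Let M0 : M 0.
Proof. by rewrite -(mulr0 t); exact: M_mul. Qed.

Let nM_neq0 f : ~ M f -> f != 0.
Proof. by move=> nMf; apply/eqP => f0; apply: nMf; rewrite f0. Qed.

Let nM_mul f g : R f -> R g -> ~ M f -> ~ M g -> ~ M (f * g).
Proof. by move=> Rf Rg nf ng /M_prime[]. Qed.

Let rep_neq0 f n : rep f n -> f != 0.
Proof.
case=> s [s' [_ _ /nM_neq0 s0 /nM_neq0 s'0 ->]].
by rewrite !mulf_neq0 ?invr_eq0 // expfz_neq0.
Qed.

Let rep_nonM f : R f -> ~ M f -> rep f 0.
Proof. by move=> Rf nMf; exists f, 1; rewrite divr1 expr0z mul1r. Qed.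

Let rep_nat f : R f -> f != 0 -> exists n : nat, rep f n.
Proof.
move=> Rf f0; have [n0 Hn0] := R_separated Rf f0.
have ex : exists n, `[< ~ R (psi ^+ n * f / t ^+ n) >] by exists n0; apply/asboolP.
case: (ex_minnP ex) => -[|n] /asboolP Hn Hmin.
  by case: Hn; rewrite !expr0 mul1r divr1.
pose g := psi ^+ n * f / t ^+ n.
have Rg : R g.
  apply: contrapT => /asboolP/Hmin; by rewrite ltnn.
have nMg : ~ M g.
  move=> /M_psiP - /(_ Rg); rewrite /g.
  have -> : psi * (psi ^+ n * f / t ^+ n) / t = psi ^+ n.+1 * f / t ^+ n.+1.
    by rewrite !exprS; field; rewrite t_neq0 expf_neq0.
  exact: Hn.
have Rpn : R (psi ^+ n) by exact: RX.
have nMpn : ~ M (psi ^+ n).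
  by elim: (n) => [|k IH]; rewrite ?expr0 ?exprS //; apply: nM_mul => //; exact: RX.
exists n, g, (psi ^+ n); split=> //; rewrite /g -exprnP.
by field; rewrite !expf_neq0 //; exact: nM_neq0.
Qed.

Let repM f g n m : rep f n -> rep g m -> rep (f * g) (n + m).
Proof.
case=> s [s' [Rs Rs' Ms Ms' ->]] [u [u' [Ru Ru' Mu Mu' ->]]].
exists (s * u), (s' * u'); split; [exact: R_mul|exact: R_mul|exact: nM_mul|exact: nM_mul|].
rewrite expfzDr //; field; by rewrite !nM_neq0.
Qed.

Let repV f n : rep f n -> rep f^-1 (- n).
Proof.
case=> s [s' [Rs Rs' Ms Ms' ->]]; exists s', s; split=> //.
by rewrite -invr_expz; field; rewrite expfz_neq0 // !nM_neq0.
Qed.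

Lemma unit_rep_ex f : f != 0 -> exists n, rep f n.
Proof.
move=> f0; have [g [h [Rg Rh h0 fE]]] := R_frac f.
have g0 : g != 0 by apply: contraNneq f0 => g0; rewrite fE g0 mul0r.
have [n rg] := rep_nat Rg g0; have [m rh] := rep_nat Rh h0.
by exists (n%:Z - m%:Z); rewrite fE; apply: repM => //; exact: repV.
Qed.

Let rep1_le0 n : rep 1 n -> n <= 0.
Proof.
case=> s [s' [Rs Rs' Ms Ms' E]]; rewrite leNgt; apply/negP => n0; apply: (Ms').
case: n n0 E => [[|n]|n] // _ E.
have -> : s' = t * (t ^+ n * s).
  by rewrite mulrA -exprS -[RHS](divfK (nM_neq0 Ms')) -[X in X * s']E mul1r.
by apply: M_mul => //; apply: R_mul => //; exact: RX.
Qed.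

Lemma unit_rep_uniq f n m : rep f n -> rep f m -> n = m.
Proof.
move=> rn rm; have f0 := rep_neq0 rn.
have := repM rn (repV rm); have := repM rm (repV rn).
by rewrite mulfV // => /rep1_le0 ? /rep1_le0 ?; lia.
Qed.

Let val f : int := xget 0 [set n | rep f n]%classic.

Let valE f n : rep f n -> val f = n.
Proof.
by move=> r; apply: xget_unique => // m /(unit_rep_uniq r) ->.
Qed.

Let val_ge (f : L) : f != 0 ->
  (exists s s', [/\ R s, R s', ~ M s' & f = s / s']) -> 0 <= val f.
Proof.
move=> f0 [s [s' [Rs Rs' Ms' fE]]].
have s0 : s != 0 by apply: contraNneq f0 => s0; rewrite fE s0 mul0r.
have [k rk] := rep_nat Rs s0.
by rewrite fE (valE (repM rk (repV (rep_nonM Rs' Ms')))); lia.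
Qed.

Let valM (f g : L) : f != 0 -> g != 0 -> val (f * g) = val f + val g.
Proof.
move=> /unit_rep_ex[n rn] /unit_rep_ex[m rm].
by rewrite (valE rn) (valE rm) (valE (repM rn rm)).
Qed.

Let val_tX n : val (t ^ n) = n.
Proof. by apply: valE; exists 1, 1; split=> //; rewrite mulr1 divr1. Qed.

Let valD (f g : L) : f != 0 -> g != 0 -> f + g != 0 ->
  Order.min (val f) (val g) <= val (f + g).
Proof.
wlog le_fg : f g / val f <= val g.
  move=> W f0 g0 fg0; case: (leP (val f) (val g)) => [H|/ltW H].
    by have := W f g H f0 g0 fg0; case: leP H => // /lt_geF ->.
  rewrite addrC in fg0 *; have := W g f H g0 f0 fg0.
  by case: leP H => // /lt_geF ->.
move=> f0 g0 fg0; rewrite (min_idPl le_fg).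
have [n rn] := unit_rep_ex f0; have [m rm] := unit_rep_ex g0.
move: le_fg; rewrite (valE rn) (valE rm) => le_nm.
case: rn rm => s [s' [Rs Rs' Ms Ms' fE]] [u [u' [Ru Ru' Mu Mu' gE]]].
have [k kE] : exists k : nat, m = n + k by exists `|m - n|%N; lia.
have E : f + g = t ^ n * ((s * u' + t ^+ k * u * s') / (s' * u')).
  rewrite fE gE kE expfzDr // -exprnP; field; by rewrite !nM_neq0.
have q0 : (s * u' + t ^+ k * u * s') / (s' * u') != 0.
  by apply: contraNneq fg0 => q0; rewrite E q0 mulr0.
rewrite E valM ?expfz_neq0 // val_tX lerDl.
apply: val_ge => //; exists (s * u' + t ^+ k * u * s'), (s' * u').
split=> //; last exact: nM_mul.
- by apply: R_add; do ?apply: R_mul => //; exact: RX.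
- exact: R_mul.
Qed.

Let val0 : val 0 = 0.
Proof. by apply: xgetPN => n /rep_neq0; rewrite eqxx. Qed.

Let val_const c : val (of_const L c) = 0.
Proof.
have [->|c0] := eqVneq c 0; first by rewrite /of_const rmorph0 val0.
apply/valE/rep_nonM => // Mc; apply: nM1.
have <- : of_const L c * of_const L c^-1 = 1.
  by rewrite -rmorphM -polyCM mulfV // rmorph1.
by apply: M_mul; first exact: R_const; first exact: R_const.
Qed.

Let val_unif : exists u, val u = 1. Proof. by exists (t ^ 1); rewrite val_tX. Qed.

(** This is how a place is obtained from a prime [M] of a subring [R] with
    fraction field [L], if the localization at [M] is a discrete valuation ring.
    That is the case if [t] generates [M] up to a factor [psi] outside [M]
    and no nonzero element is divisible by all powers of [t]. *)
Lemma place_of_prime : exists P : place L,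
  (forall f n, rep f n -> P f = n) /\ (forall f, R f -> vge P 0 f).
Proof.
exists (Place val0 valM valD val_const val_unif); split=> [|f Rf]; first exact: valE.
have [->|f0] := eqVneq f 0; first exact: vge0.
by rewrite vgeP //; apply: val_ge => //; exists f, 1; rewrite divr1.
Qed.

End UnitRep.

(** * Irreducible polynomials, and degrees in cubic expressions *)

Section Polynomials.
Variable K : idomainType.
Implicit Types (a b c p q Q B : {poly K}).

Lemma irredp_dvdM Q p q : irreducible_poly Q -> Q %| p * q -> (Q %| p) || (Q %| q).
Proof.
move=> irrQ QM; case: (boolP (Q %| p)) => //= nQp.
by move: QM; rewrite Gauss_dvdpr // irreducible_poly_coprime.
Qed.

Lemma irredp_dvdX Q p n : irreducible_poly Q -> Q %| p ^+ n -> Q %| p.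
Proof.
move=> irrQ; elim: n => [|n IH]; last by rewrite exprS => /(irredp_dvdM irrQ)/orP[].
by rewrite expr0 dvdp1 => /eqP sQ; case: irrQ; rewrite sQ.
Qed.

Lemma exists_irredp p : (1 < size p)%N -> exists2 Q, irreducible_poly Q & Q %| p.
Proof.
elim: {p}(size p) {-2}p (leqnn (size p)) => [|n IH] p; first by case: (size p).
move=> pn p1; have [irr|] := pselect (irreducible_poly p); first by exists p.
move=> /not_andP[//|/existsNP[q /not_implyP[q1 /not_implyP[qp npq]]]].
have p0 : p != 0 by rewrite -size_poly_gt0; lia.
have q0 : q != 0 by apply: contraNneq p0 => q0; rewrite q0 dvd0p in qp.
have sqp : (size q < size p)%N.
  by rewrite ltn_neqAle dvdp_leq // andbT; apply: contra_notN npq; rewrite dvdp_size_eqp.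
have [||Q irrQ Qq] := IH q; first by rewrite -ltnS (leq_trans sqp).
  by move: q1 q0; rewrite -size_poly_eq0; case: (size q) => [|[|]].
by exists Q => //; exact: dvdp_trans qp.
Qed.

(** The exponent only has to make the degree of the power exceed that of [p]. *)
Lemma irredp_expn_ndvd Q p : irreducible_poly Q -> p != 0 -> ~~ (Q ^+ size p %| p).
Proof.
move=> irrQ p0; apply/negP => /(dvdp_leq p0); have Q0 := irredp_neq0 irrQ.
have [sQ _] := irrQ.
rewrite leqNgt => /negP; apply; rewrite -[X in (_ < X)%N]prednK; last first.
  by rewrite size_poly_gt0 expf_neq0.
rewrite size_exp ltnS; apply: leq_pmull; lia.
Qed.

Lemma size_polyD_neq p q : (p != 0 -> q != 0 -> size p != size q) ->
  size (p + q) = maxn (size p) (size q).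
Proof.
have [->|p0] := eqVneq p 0; first by rewrite add0r size_poly0 max0n.
have [->|q0] := eqVneq q 0; first by rewrite addr0 size_poly0 maxn0.
move=> /(_ isT isT); rewrite neq_ltn => /orP[pq|qp].
  by rewrite addrC size_polyDl // (maxn_idPr _) // ltnW.
by rewrite size_polyDl // (maxn_idPl _) // ltnW.
Qed.

(** The norm of [a + b y + c y^2] if [y^3 = B]. *)
Definition cubic_norm B a b c :=
  a ^+ 3 + b ^+ 3 * B + c ^+ 3 * B ^+ 2 - a * b * c * B *+ 3.

Lemma size_expS p n : p != 0 -> size (p ^+ n) = ((size p).-1 * n).+1.
Proof. by move=> p0; rewrite -size_exp prednK // size_poly_gt0 expf_neq0. Qed.

Lemma size_mulS p q : p != 0 -> q != 0 ->
  size (p * q) = ((size p).-1 + (size q).-1).+1.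
Proof.
move=> p0 q0; rewrite size_mul //.
by move: p0 q0; rewrite -!size_poly_gt0; lia.
Qed.

Lemma size_expMS p q n : p != 0 -> q != 0 ->
  size (p ^+ n * q) = ((size p).-1 * n + (size q).-1).+1.
Proof. by move=> p0 q0; rewrite size_mulS ?expf_neq0 // size_expS. Qed.

(** The first three terms have distinct degrees modulo 3, so that they cannot
    cancel; the last one has at most the average of their degrees. *)
Lemma size_cubic_norm B a b c : ~~ (3 %| (size B).-1)%N ->
  size (cubic_norm B a b c) =
  maxn (maxn (size (a ^+ 3)) (size (b ^+ 3 * B))) (size (c ^+ 3 * B ^+ 2)).
Proof.
move=> hB; have B0 : B != 0 by apply: contraNneq hB => ->; rewrite size_poly0.
have sA : a != 0 -> size (a ^+ 3) = ((size a).-1 * 3).+1.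
  by move=> a0; rewrite size_expS.
have sB : b != 0 -> size (b ^+ 3 * B) = ((size b).-1 * 3 + (size B).-1).+1.
  by move=> b0; rewrite size_mulS ?expf_neq0 // size_expS.
have sC : c != 0 -> size (c ^+ 3 * B ^+ 2) = ((size c).-1 * 3 + (size B).-1 * 2).+1.
  by move=> c0; rewrite size_mulS ?expf_neq0 // !size_expS.
have zA : (a ^+ 3 != 0) -> a != 0 by rewrite expf_eq0.
have zB : (b ^+ 3 * B != 0) -> b != 0 by rewrite mulf_eq0 negb_or expf_eq0 => /andP[].
have zC : (c ^+ 3 * B ^+ 2 != 0) -> c != 0.
  by rewrite mulf_eq0 negb_or expf_eq0 => /andP[].
have s12 : size (a ^+ 3 + b ^+ 3 * B) = maxn (size (a ^+ 3)) (size (b ^+ 3 * B)).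
  by apply: size_polyD_neq => /zA/sA -> /zB/sB ->; lia.
have s123 : size (a ^+ 3 + b ^+ 3 * B + c ^+ 3 * B ^+ 2) =
  maxn (maxn (size (a ^+ 3)) (size (b ^+ 3 * B))) (size (c ^+ 3 * B ^+ 2)).
  rewrite -s12; apply: size_polyD_neq => + /zC/sC ->; rewrite -size_poly_gt0 s12.
  have [->|/sA ->] := eqVneq a 0; have [->|/sB ->] := eqVneq b 0;
    rewrite ?expr0n ?mul0r ?size_poly0; lia.
have sM : (size (a * b * c * B *+ 3)%R <= size (a * b * c * B)%R)%N.
  by rewrite -mulr_natl -polyC1 -polyCMn mul_polyC size_scale_leq.
have [abc0|] := eqVneq (a * b * c) 0.
  by rewrite /cubic_norm abc0 mul0r mul0rn subr0.
rewrite !mulf_eq0 !negb_or => /andP[/andP[a0 b0] c0].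
rewrite -s123; apply: size_polyDl; rewrite size_polyN s123 sA // sB // sC //.
apply: leq_ltn_trans sM _; rewrite !(size_mulS, mulf_neq0) //=.
clear -hB; move: (size a).-1 (size b).-1 (size c).-1 (size B).-1 hB => u v w m hB.
lia.
Qed.

Lemma cubic_norm_eq0 B a b c : ~~ (3 %| (size B).-1)%N ->
  cubic_norm B a b c = 0 -> [/\ a = 0, b = 0 & c = 0].
Proof.
move=> hB /eqP; rewrite -size_poly_eq0 size_cubic_norm // => H.
have B0 : B != 0 by apply: contraNneq hB => ->; rewrite size_poly0.
have : [&& size (a ^+ 3) == 0%N, size (b ^+ 3 * B) == 0%N & size (c ^+ 3 * B ^+ 2) == 0%N].
  by lia.
rewrite !size_poly_eq0 => /and3P[]; rewrite expf_eq0 /= => /eqP->.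
rewrite mulf_eq0 (negPf B0) orbF expf_eq0 /= => /eqP->.
by rewrite mulf_eq0 !expf_eq0 (negPf B0) orbF /= => /eqP->.
Qed.

(** The two sums are, up to a factor 3, the coordinates at [y] and [y^2] of
    [(a + b y + c y^2)^3]. If [a], [b] and [c] were nonzero, then, the degrees
    of [a^3], [b^3 B] and [c^3 B^2] being distinct, one of the two sums would
    have a term of strictly largest degree. *)
Lemma cubic_cube_coord B a b c : ~~ (3 %| (size B).-1)%N ->
  a ^+ 2 * b + b ^+ 2 * c * B + a * c ^+ 2 * B = 0 ->
  a * b ^+ 2 + a ^+ 2 * c + b * c ^+ 2 * B = 0 ->
  [\/ b = 0 /\ c = 0, a = 0 /\ c = 0 | a = 0 /\ b = 0].
Proof.
move=> hB; have B0 : B != 0 by apply: contraNneq hB => ->; rewrite size_poly0.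
have [->|a0] := eqVneq a 0.
  rewrite expr0n /= !(mul0r, add0r, addr0) => /eqP.
  rewrite !mulf_eq0 (negPf B0) orbF orbb => /orP[/eqP->|/eqP->] _.
    exact: Or33.
  exact: Or32.
have [->|b0] := eqVneq b 0.
  rewrite expr0n /= !(mul0r, mulr0, add0r, addr0) => /eqP.
  rewrite !mulf_eq0 (negPf B0) (negPf a0) orbF orbb => /eqP-> _.
  exact: Or31.
have [->|c0] := eqVneq c 0.
  rewrite expr0n /= !(mul0r, mulr0, add0r, addr0) => /eqP.
  by rewrite !mulf_eq0 (negPf b0) (negPf a0).
move=> /eqP E1 /eqP E2; exfalso.
have dom p q (r : {poly K}) : (size q < size p)%N -> (size r < size p)%N -> p + q + r != 0.
  move=> qp rp; rewrite -size_poly_gt0 -addrA size_polyDl; first by lia.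
  by apply: leq_ltn_trans (size_polyD _ _) _; rewrite gtn_max qp.
have dom2 p q (r : {poly K}) : (size q < size p)%N -> (size r < size p)%N -> q + p + r != 0.
  by rewrite (addrC q); exact: dom.
have dom3 p q (r : {poly K}) : (size q < size p)%N -> (size r < size p)%N -> q + r + p != 0.
  by rewrite addrC addrA; exact: dom.
have sE := (size_mulS, size_expS, mulf_neq0, expf_neq0).
have [H|[H|H]] : let: (u, v, w) := ((size a).-1 * 3, (size b).-1 * 3 + (size B).-1,
    (size c).-1 * 3 + (size B).-1 * 2)%N in
  ((v < u /\ w < u) \/ (u < v /\ w < v) \/ (u < w /\ v < w))%N by lia.
- case: (ltnP ((size b).-1 * 3 + (size B).-1) ((size c).-1 * 3 + (size B).-1 * 2)) => H2.
  + by move: E2; apply/negP; apply: dom2; rewrite !sE //=;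
    move: H H2; move: (size a).-1 (size b).-1 (size c).-1 (size B).-1; lia.
  + by move: E1; apply/negP; apply: dom; rewrite !sE //=;
    move: H H2; move: (size a).-1 (size b).-1 (size c).-1 (size B).-1; lia.
- case: (ltnP ((size a).-1 * 3) ((size c).-1 * 3 + (size B).-1 * 2)) => H2.
  + by move: E1; apply/negP; apply: dom2; rewrite !sE //=;
    move: H H2; move: (size a).-1 (size b).-1 (size c).-1 (size B).-1; lia.
  + by move: E2; apply/negP; apply: dom; rewrite !sE //=;
    move: H H2; move: (size a).-1 (size b).-1 (size c).-1 (size B).-1; lia.
- case: (ltnP ((size a).-1 * 3) ((size b).-1 * 3 + (size B).-1)) => H2.
  + by move: E2; apply/negP; apply: dom3; rewrite !sE //=;
    move: H H2; move: (size a).-1 (size b).-1 (size c).-1 (size B).-1; lia.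
  + by move: E1; apply/negP; apply: dom3; rewrite !sE //=;
    move: H H2; move: (size a).-1 (size b).-1 (size c).-1 (size B).-1; lia.
Qed.

(** The three polynomials are the coordinates of [(a + b y + c y^2)^2], so this
    says that [K[x][y]] is reduced modulo [Q]. Eliminating between them, [Q]
    divides [9 a c^2 B]. *)
Lemma cubic_square_coord Q B a b c :
  irreducible_poly Q -> ~~ (Q %| B) -> 3%:R != 0 :> K ->
  Q %| a ^+ 2 + b * c * B *+ 2 -> Q %| a * b *+ 2 + c ^+ 2 * B ->
  Q %| b ^+ 2 + a * c *+ 2 -> [/\ Q %| a, Q %| b & Q %| c].
Proof.
move=> irrQ nQB ch3 QX QY QZ.
have : Q %| (3%:R : {poly K}) ^+ 2 * (a * c ^+ 2) * B.
  have -> : (3%:R : {poly K}) ^+ 2 * (a * c ^+ 2) * B =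
      a * (a * b *+ 2 + c ^+ 2 * B) - b *+ 2 * (a ^+ 2 + b * c * B *+ 2)
      + c * B *+ 4 * (b ^+ 2 + a * c *+ 2) by ring.
  by rewrite dvdp_add ?dvdp_sub // dvdp_mull.
have n3 : (3%:R : {poly K}) = (3%:R)%:P by rewrite polyCMn.
move/(irredp_dvdM irrQ); rewrite (negPf nQB) orbF n3 -polyC_exp mul_polyC.
rewrite dvdpZr ?expf_neq0 // => /(irredp_dvdM irrQ)/orP[Qa|/(irredp_dvdX irrQ) Qc].
  have Qb : Q %| b.
    by apply: (@irredp_dvdX _ _ 2) => //; move: QZ; rewrite dvdp_addl // -mulrnAr dvdp_mulr.
  split=> //; move: QY; rewrite addrC dvdp_addl; last by rewrite -mulrnAr dvdp_mulr.
  by move/(irredp_dvdM irrQ); rewrite (negPf nQB) orbF => /(irredp_dvdX irrQ).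
have Qb : Q %| b.
  by apply: (@irredp_dvdX _ _ 2) => //; move: QZ; rewrite dvdp_addl // -mulrnAl dvdp_mull.
split=> //; apply: (@irredp_dvdX _ _ 2) => //; move: QX.
by rewrite dvdp_addl // -mulrA -mulrnAr dvdp_mulr.
Qed.

End Polynomials.

Lemma irredp_factor (K : fieldType) (Q p : {poly K}) : irreducible_poly Q -> p != 0 ->
  exists k q, p = Q ^+ k * q /\ ~~ (Q %| q).
Proof.
move=> irrQ p0; have ex : exists k, ~~ (Q ^+ k %| p).
  by exists (size p); exact: irredp_expn_ndvd.
case: (ex_minnP ex) => -[|k]; first by rewrite expr0 dvd1p.
move=> nQk min_k; have [|nQ] := boolP (Q ^+ k %| p); last by have := min_k _ nQ; rewrite ltnn.
case/dvdpP => q pE; exists k, q; rewrite mulrC; split=> //.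
by apply: contra nQk; rewrite pE exprS => Qq; exact: dvdp_mul Qq _.
Qed.

(** * Places above a prime of K[x], and their degrees *)

Section PlaceAbove.
Variables (K : fieldType) (L : fieldExtType {fraction {poly K}}).
Implicit Types (P : place L) (p Q : {poly K}).
Local Notation ev := (of_poly L).

(** In Horner form, the term with the highest power of [x] has the strictly
    lowest value. *)
Lemma place_val_poly_lead P p (k : int) : 0 < k -> P (ev 'X) = - k -> p != 0 ->
  P (ev p) = - k * (size p).-1%:Z.
Proof.
move=> k0 PX; elim/poly_ind: p => [|q c IH]; first by rewrite eqxx.
move=> _.
have [->|q0] := eqVneq q 0.
  rewrite mul0r add0r place_val_const; case: (size _) (size_polyC_leq1 c) => [|[|]] //; lia.
rewrite size_MXaddC (negPf q0) /= rmorphD rmorphM.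
have q'0 : ev q != 0 by rewrite of_poly_eq0.
have X0 : ev 'X != 0 by rewrite of_poly_eq0 polyX_eq0.
have Pq : P (ev q * ev 'X) = - k * (size q)%:Z.
  rewrite place_valM // IH // PX; have : (0 < size q)%N by rewrite size_poly_gt0.
  by move: (size q) => n n0; rewrite -[in RHS](prednK n0); lia.
have Pc : vge P (P (ev q * ev 'X) + 1) (ev c%:P).
  apply: vgeW (vge_const P c); rewrite Pq.
  have : (0 < size q)%N by rewrite size_poly_gt0.
  by move: (size q) => n n0; nia.
by rewrite (place_val_dominant (mulf_neq0 q'0 X0) Pc).2.
Qed.

Lemma vge_poly P p : 0 <= P (ev 'X) -> vge P 0 (ev p).
Proof.
move=> PX; elim/poly_ind: p => [|q c IH]; first by rewrite rmorph0 vge0.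
rewrite rmorphD rmorphM; apply: vgeD (vge_const _ _).
by rewrite -[0]addr0; apply: vgeM => //; rewrite /vge PX orbT.
Qed.

Definition place_above P Q : Prop := 0 <= P (ev 'X) /\ 0 < P (ev Q).

Section Above.
Variables (P : place L) (Q : {poly K}).
Hypotheses (irrQ : irreducible_poly Q) (PQ : place_above P Q).

Lemma vge_above p : Q %| p -> vge P (P (ev Q)) (ev p).
Proof.
move=> /dvdpP[q ->]; rewrite rmorphM mulrC -[X in vge P X]addr0.
by apply: vgeM (vge_val _ _) (vge_poly _ PQ.1).
Qed.

Lemma vge1_above p : Q %| p -> vge P 1 (ev p).
Proof. by move=> /vge_above; apply: vgeW; have := PQ.2; lia. Qed.

(** Otherwise [1] would be a combination of [p] and [Q], hence of positive
    value. *)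
Lemma vge1_poly p : vge P 1 (ev p) = (Q %| p).
Proof.
apply/idP/idP => [Pp|/vge1_above//]; apply: contraTT (Pp) => nQp.
have /Bezout_eq1_coprimepP[[u v] /= uv1] : coprimep Q p.
  by rewrite irreducible_poly_coprime.
apply/negP => _; suff : vge P 1 (1 : L) by rewrite /vge oner_eq0 place_val1.
rewrite -(rmorph1 ev) -uv1 rmorphD !rmorphM -[1]add0r.
by apply: vgeD; apply: vgeM; rewrite ?vge_poly ?PQ.1 // vge1_above.
Qed.

Lemma place_val_above0 p : ~~ (Q %| p) -> P (ev p) = 0.
Proof.
move=> nQp; have p0 : ev p != 0.
  by rewrite of_poly_eq0; apply: contraNneq nQp => ->; exact: dvdp0.
move: nQp (vge_poly p PQ.1); rewrite -vge1_poly !vgeP //; lia.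
Qed.

Lemma place_val_above p : exists k : nat, P (ev p) = P (ev Q) * k%:Z.
Proof.
have [->|p0] := eqVneq p 0; first by exists 0%N; rewrite rmorph0 place_val0 mulr0.
have [k [q [pE nQq]]] := irredp_factor irrQ p0; exists k.
have q0 : ev q != 0 by rewrite of_poly_eq0; apply: contraNneq nQq => ->; exact: dvdp0.
rewrite pE rmorphM rmorphXn place_valM ?expf_neq0 // ?of_poly_eq0 ?irredp_neq0 //.
by rewrite place_valX (place_val_above0 nQq) addr0.
Qed.

Lemma of_poly_rVpoly n (a : 'rV[K]_n) :
  \sum_(i < n) of_const L (a 0 i) * ev 'X^i = ev (rVpoly a).
Proof.
have -> : rVpoly a = \sum_(i < n) (a 0 i) *: 'X^i.
  apply/polyP => k; rewrite coef_rVpoly coef_sum.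
  case: insubP => [i _ <-|nk].
    rewrite (bigD1 i) //= coefZ coefXn eqxx mulr1 big1 ?addr0 // => j ji.
    by rewrite coefZ coefXn (inj_eq val_inj) eq_sym (negPf ji) mulr0.
  rewrite big1 // => j _; rewrite coefZ coefXn; case: eqP => [E|_]; last by rewrite mulr0.
  by rewrite E ltn_ord in nk.
by rewrite rmorph_sum; apply: eq_bigr => i _; rewrite -mul_polyC rmorphM.
Qed.

(** If every residue class contains a polynomial, then it contains exactly one
    polynomial of degree less than that of [Q]. *)
Lemma residue_basis_above :
  (forall f, vge P 0 f -> exists p, vge P 1 (f - ev p)) ->
  residue_basis P (fun i : 'I_(size Q).-1 => ev 'X^i).
Proof.
move=> res; have sQ : (size Q).-1.+1 = size Q.
  by rewrite prednK // size_poly_gt0 irredp_neq0.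
split=> [i|f]; first by rewrite in_valuation_ringE vge_poly ?PQ.1.
rewrite in_valuation_ringE => /res[p fp]; exists (poly_rV (p %% Q)).
have sp : (size (p %% Q)%R <= (size Q).-1)%N.
  by rewrite -ltnS sQ ltn_modp irredp_neq0.
split=> [|a].
  rewrite in_maximal_idealE of_poly_rVpoly poly_rV_K //.
  rewrite -[f](subrK (ev p)) -addrA; apply: vgeD => //.
  by rewrite -rmorphB {1}(divp_eq p Q) addrK vge1_above // dvdp_mulIr.
rewrite in_maximal_idealE of_poly_rVpoly => fa.
have : Q %| p - rVpoly a.
  rewrite -vge1_poly; have -> : ev (p - rVpoly a) = (f - ev (rVpoly a)) - (f - ev p).
    by rewrite rmorphB; ring.
  exact: vgeB.
rewrite /dvdp modpD modpN subr_eq0 => /eqP ->; rewrite modp_small ?rVpolyK //.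
by rewrite -[X in (_ < X)%N]sQ ltnS size_poly.
Qed.

End Above.
End PlaceAbove.

Section PlaceDegree.
Variables (K : finFieldType) (L : fieldExtType {fraction {poly K}}).
Implicit Type P : place L.

(** Counting is enough over a finite field: the coordinates on [b'] embed the
    [#|K| ^ n] combinations of [b] into those of [b']. *)
Lemma residue_basis_leq P n m (b : 'I_n -> L) (b' : 'I_m -> L) :
  residue_basis P b -> residue_basis P b' -> (n <= m)%N.
Proof.
move=> [Ob Hb] [Ob' Hb'].
pose f (a : 'rV[K]_n) := \sum_(i < n) of_const L (a 0 i) * b i.
have Of a : in_valuation_ring P (f a).
  rewrite in_valuation_ringE; apply: vge_sum => i; rewrite -[0]addr0.
  by apply: vgeM (vge_const _ _) _; rewrite -in_valuation_ringE.
pose F a := projT1 (cid (Hb' _ (Of a))).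
have FP a : in_maximal_ideal P (f a - \sum_(i < m) of_const L (F a 0 i) * b' i).
  exact: (projT2 (cid (Hb' _ (Of a)))).1.
have Finj : injective F.
  move=> a1 a2 E; have [a [_ ua]] := Hb _ (Of a1).
  rewrite -(ua a1) ?subrr ?in_maximal_idealE ?vge0 //; apply: ua.
  move: (FP a1) (FP a2).
  rewrite E !in_maximal_idealE => H1 H2; have := vgeB H1 H2.
  by rewrite opprB addrA subrK.
have := leq_card F Finj; rewrite !card_mx !mul1n leq_exp2l //.
exact: card_finRing_gt1.
Qed.

Lemma place_degreeE P n (b : 'I_n -> L) : residue_basis P b -> place_degree P = n.
Proof.
move=> Hb; apply: xget_unique; first by exists b.
move=> m [b' Hb']; apply/eqP; rewrite eqn_leq.
by rewrite (residue_basis_leq Hb Hb') (residue_basis_leq Hb' Hb).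
Qed.

End PlaceDegree.

(** * The order K[x][y] and its ramified primes *)

Section CubicOrder.
Variables (K : fieldType) (L : fieldExtType {fraction {poly K}}) (y : L).
Implicit Types (P : place L) (a b c d p q Q B : {poly K}) (f g : L).
Local Notation ev := (of_poly L).

Definition cubic_elt a b c : L := ev a + ev b * y + ev c * y ^+ 2.

(** If [y^3] is a polynomial, this is the order [K[x][y]]. *)
Definition cubic_int f : Prop := exists a b c, f = cubic_elt a b c.

(** [1], [y] and [y^2] span [L] over [K(x)]; one common denominator is used. *)
Definition cubic_span : Prop :=
  forall f, exists a b c d, d != 0 /\ f = cubic_elt a b c / ev d.

Lemma cubic_eltD a b c a' b' c' :
  cubic_elt a b c + cubic_elt a' b' c' = cubic_elt (a + a') (b + b') (c + c').
Proof. by rewrite /cubic_elt !rmorphD /=; ring. Qed.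

Lemma cubic_eltB a b c a' b' c' :
  cubic_elt a b c - cubic_elt a' b' c' = cubic_elt (a - a') (b - b') (c - c').
Proof. by rewrite /cubic_elt !rmorphB /=; ring. Qed.

Lemma cubic_eltZ p a b c :
  ev p * cubic_elt a b c = cubic_elt (p * a) (p * b) (p * c).
Proof. by rewrite /cubic_elt !rmorphM /=; ring. Qed.

Lemma cubic_elt_poly p : cubic_elt p 0 0 = ev p.
Proof. by rewrite /cubic_elt !rmorph0; ring. Qed.

Lemma cubic_int_elt a b c : cubic_int (cubic_elt a b c).
Proof. by exists a, b, c. Qed.

Lemma cubic_int_poly p : cubic_int (ev p).
Proof. by rewrite -cubic_elt_poly; exact: cubic_int_elt. Qed.

Lemma cubic_int_const k : cubic_int (of_const L k).
Proof. exact: cubic_int_poly. Qed.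

Lemma cubic_intD f g : cubic_int f -> cubic_int g -> cubic_int (f + g).
Proof.
by move=> [a [b [c ->]]] [a' [b' [c' ->]]]; rewrite cubic_eltD; exact: cubic_int_elt.
Qed.

Lemma cubic_gen_elt : y = cubic_elt 0 1 0.
Proof. by rewrite /cubic_elt !rmorph0 rmorph1; ring. Qed.

Lemma cubic_int_gen : cubic_int y.
Proof. by rewrite [X in cubic_int X]cubic_gen_elt; exact: cubic_int_elt. Qed.

Variable B : {poly K}.
Hypotheses (hB : ~~ (3 %| (size B).-1)%N) (hy : y ^+ 3 = ev B).

Lemma cubic_eltM a b c a' b' c' :
  cubic_elt a b c * cubic_elt a' b' c' =
  cubic_elt (a * a' + (b * c' + c * b') * B) (a * b' + b * a' + c * c' * B)
    (a * c' + b * b' + c * a').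
Proof. by rewrite /cubic_elt !(rmorphD, rmorphM) /= -hy; ring. Qed.

Lemma cubic_elt_mulgen a b c : cubic_elt a b c * y = cubic_elt (c * B) a b.
Proof. by rewrite /cubic_elt rmorphM /= -hy; ring. Qed.

(** The second factor is the product of the other two conjugates. *)
Lemma cubic_elt_norm a b c :
  cubic_elt a b c * cubic_elt (a ^+ 2 - b * c * B) (c ^+ 2 * B - a * b) (b ^+ 2 - a * c)
  = ev (cubic_norm B a b c).
Proof.
rewrite cubic_eltM -cubic_elt_poly /cubic_norm; congr cubic_elt; ring.
Qed.

Lemma cubic_normM a b c a' b' c' :
  cubic_norm B a b c * cubic_norm B a' b' c' =
  cubic_norm B (a * a' + (b * c' + c * b') * B) (a * b' + b * a' + c * c' * B)
    (a * c' + b * b' + c * a').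
Proof. by rewrite /cubic_norm; ring. Qed.

(** Linear independence of [1], [y] and [y^2]: a vanishing element has norm 0,
    and the norm vanishes only on 0 for reasons of degree. *)
Lemma cubic_elt_eq0 a b c : cubic_elt a b c = 0 -> [/\ a = 0, b = 0 & c = 0].
Proof.
move=> E; apply: (cubic_norm_eq0 hB); apply/eqP.
by rewrite -(of_poly_eq0 L) -cubic_elt_norm E mul0r.
Qed.

Lemma cubic_elt_inj a b c a' b' c' :
  cubic_elt a b c = cubic_elt a' b' c' -> [/\ a = a', b = b' & c = c'].
Proof.
move/eqP; rewrite -subr_eq0 cubic_eltB => /eqP/cubic_elt_eq0[].
by move=> /subr0_eq-> /subr0_eq-> /subr0_eq->.
Qed.

Lemma cubic_intM f g : cubic_int f -> cubic_int g -> cubic_int (f * g).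
Proof.
by move=> [a [b [c ->]]] [a' [b' [c' ->]]]; rewrite cubic_eltM; exact: cubic_int_elt.
Qed.

Lemma cubic_intX f n : cubic_int f -> cubic_int (f ^+ n).
Proof.
move=> If; elim: n => [|n IH]; last by rewrite exprS; exact: cubic_intM.
by rewrite expr0 -(rmorph1 ev); exact: cubic_int_poly.
Qed.

Lemma place_val_gen P : P y * 3 = P (ev B).
Proof. by rewrite -hy place_valX. Qed.

Lemma cubic_int_norm f : cubic_int f -> f != 0 ->
  exists g p, [/\ cubic_int g, p != 0 & f * g = ev p].
Proof.
case=> a [b [c ->]] f0; do 2!eexists; split; [| |exact: cubic_elt_norm].
  exact: cubic_int_elt.
apply: contra_neq f0 => /(cubic_norm_eq0 hB)[-> -> ->].
by rewrite cubic_elt_poly rmorph0.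
Qed.

Lemma cubic_int_divr q a b c : q != 0 ->
  cubic_int (cubic_elt a b c / ev q) <-> [/\ q %| a, q %| b & q %| c].
Proof.
move=> q0; have q'0 : ev q != 0 by rewrite of_poly_eq0.
split=> [[a' [b' [c' /(canRL (divfK q'0))]]]|[/dvdpP[a' ->] /dvdpP[b' ->] /dvdpP[c' ->]]].
  by rewrite mulrC cubic_eltZ => /cubic_elt_inj[-> -> ->]; rewrite !dvdp_mulIl.
exists a', b', c'; rewrite ![_ * q]mulrC -cubic_eltZ mulrC mulKf //.
Qed.

Lemma cubic_int_divr_poly q p : q != 0 -> cubic_int (ev p / ev q) -> q %| p.
Proof. by move=> q0; rewrite -cubic_elt_poly => /(cubic_int_divr _ _ _ q0)[]. Qed.

Hypothesis span : cubic_span.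

Lemma cubic_int_frac f :
  exists g h, [/\ cubic_int g, cubic_int h, h != 0 & f = g / h].
Proof.
have [a [b [c [d [d0 ->]]]]] := span f.
exists (cubic_elt a b c), (ev d); rewrite of_poly_eq0; split=> //.
  exact: cubic_int_elt.
exact: cubic_int_poly.
Qed.

Section Ramified.
Variables Q B' : {poly K}.
Hypotheses (irrQ : irreducible_poly Q) (BE : B = Q * B') (nQB' : ~~ (Q %| B')).

(* The ideal generated by [Q] and [y]. *)
Let M f := exists a b c, f = cubic_elt a b c /\ Q %| a.

Let Q0 : Q != 0 := irredp_neq0 irrQ.

Let QB : Q %| B. Proof. by rewrite BE dvdp_mulIl. Qed.

Let B0 : B != 0.
Proof. by apply: contraNneq hB => ->; rewrite size_poly0. Qed.

Let y0 : y != 0.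
Proof.
by apply: contra_eqN hy => /eqP->; rewrite expr0n eq_sym of_poly_eq0.
Qed.

Let M_elt a b c : M (cubic_elt a b c) -> Q %| a.
Proof. by case=> a' [b' [c' [/cubic_elt_inj[-> _ _]]]]. Qed.

Let M_mul f g : cubic_int f -> cubic_int g -> M f -> M (f * g).
Proof.
move=> _ [a' [b' [c' ->]]] [a [b [c [-> Qa]]]].
rewrite cubic_eltM; do 3!eexists; split; first reflexivity.
by apply: dvdp_add; [exact: dvdp_mulr|exact: dvdp_mull].
Qed.

Let M_prime f g : cubic_int f -> cubic_int g -> M (f * g) -> M f \/ M g.
Proof.
move=> [a [b [c ->]]] [a' [b' [c' ->]]]; rewrite cubic_eltM => /M_elt.
rewrite dvdp_addl; last exact: dvdp_mull.
move=> /(irredp_dvdM irrQ)/orP[Qa|Qa].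
  by left; do 3!eexists; split; first reflexivity.
by right; do 3!eexists; split; first reflexivity.
Qed.

Let M_y : M y.
Proof. by exists 0, 1, 0; rewrite -cubic_gen_elt dvdp0. Qed.

Let nM_poly p : ~~ (Q %| p) -> ~ M (ev p).
Proof. by move=> nQp; rewrite -cubic_elt_poly => /M_elt; apply/negP. Qed.

Let M_psiP f : cubic_int f -> M f -> cubic_int (ev B' * f / y).
Proof.
move=> _ [a [b [c [-> /dvdpP[a' ->]]]]].
exists (B' * b), (B' * c), a'.
apply: (canLR (mulfK y0)).
by rewrite cubic_elt_mulgen cubic_eltZ BE; congr cubic_elt; ring.
Qed.

Let separated f : cubic_int f -> f != 0 ->
  exists n, ~ cubic_int (ev B' ^+ n * f / y ^+ n).
Proof.
move=> If f0; have [g [p [Ig p0 fg]]] := cubic_int_norm If f0.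
exists (3 * size p)%N => H.
have : cubic_int (ev (B' ^+ (3 * size p) * p) / ev (B ^+ size p)).
  have -> : ev (B' ^+ (3 * size p) * p) / ev (B ^+ size p) =
    ev B' ^+ (3 * size p) * f / y ^+ (3 * size p) * g.
    by rewrite rmorphM /= -fg !rmorphXn /= -hy -exprM; ring.
  exact: cubic_intM.
move/cubic_int_divr_poly; rewrite expf_neq0 // => /(_ isT).
move/(dvdp_trans (dvdp_exp2r (size p) QB)).
rewrite Gauss_dvdpr; first by apply/negP; exact: irredp_expn_ndvd.
by rewrite coprimep_expl // coprimep_expr // irreducible_poly_coprime.
Qed.

(** The criterion applies to the prime ideal [(Q, y)] with uniformizer [y]: as
    [Q B' = y^3], multiplication by [B'] maps this ideal into [y K[x][y]]. *)
Lemma ramified_place_ex : exists P : place L,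
  [/\ forall f n, unit_rep cubic_int M y f n -> P f = n,
      forall f, cubic_int f -> vge P 0 f &
      forall f, f != 0 -> exists n, unit_rep cubic_int M y f n].
Proof.
have [P [HP HR]] := @place_of_prime _ L cubic_int M y (ev B') cubic_int_const cubic_intD
  cubic_intM cubic_int_frac M_mul M_prime cubic_int_gen M_y y0 (cubic_int_poly _)
  (nM_poly nQB') M_psiP separated.
exists P; split=> // f f0.
exact: (@unit_rep_ex _ L cubic_int M y (ev B') cubic_int_const
  cubic_intM cubic_int_frac M_mul M_prime cubic_int_gen M_y y0 (cubic_int_poly _)
  (nM_poly nQB') M_psiP separated).
Qed.

(** Every nonzero element is a power of [y] times a quotient of elements outside
    the prime ideal. The latter have value 0 at all places above [Q], so that
    these places are multiples of each other, and thus equal. *)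
Lemma ramified_place : exists P : place L,
  [/\ place_above P Q, P (ev Q) = 3, P y = 1,
      forall f, vge P 0 f -> exists p, vge P 1 (f - ev p) &
      forall P', place_above P' Q -> P' = P].
Proof.
have [P [HP HR Hrep]] := ramified_place_ex.
have nM1 : ~ M 1.
  by rewrite -(rmorph1 ev); apply: nM_poly; rewrite dvdp1 neq_ltn; case: irrQ => ->; rewrite orbT.
have int1 : cubic_int 1 by rewrite -(rmorph1 ev); exact: cubic_int_poly.
have Py : P y = 1.
  by apply: HP; exists 1, 1; split=> //; rewrite mulr1 divr1.
have PQ : P (ev Q) = 3.
  apply: HP; exists 1, (ev B'); split=> //; [exact: cubic_int_poly|exact: nM_poly|].
  rewrite mulr1 -exprnP hy BE rmorphM mulfK // of_poly_eq0.
  by apply: contraNneq nQB' => ->; exact: dvdp0.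
have PX : 0 <= P (ev 'X).
  by rewrite -(vgeP P 0 (f := ev 'X)) ?HR ?of_poly_eq0 ?polyX_eq0 //; exact: cubic_int_poly.
have aPQ : place_above P Q by split=> //; rewrite PQ.
(* An element outside the prime has the value of its coordinate at 1. *)
have nM_val P' s : place_above P' Q -> 0 < P' y -> cubic_int s -> ~ M s -> P' s = 0.
  move=> aP' P'y [a [b [c ->]]] nMs.
  have nQa : ~~ (Q %| a) by apply/negP => Qa; apply: nMs; exists a, b, c.
  have Pa := place_val_above0 irrQ aP' nQa.
  have a0 : ev a != 0.
    by rewrite of_poly_eq0; apply: contraNneq nQa => ->; exact: dvdp0.
  have yV : vge P' 1 y by rewrite vgeP.
  have rest : vge P' (P' (ev a) + 1) (ev b * y + ev c * y ^+ 2).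
    have -> : ev b * y + ev c * y ^+ 2 = (ev b + ev c * y) * y by ring.
    rewrite Pa; apply: vgeM (yV); apply: vgeD; first exact: vge_poly aP'.1.
    rewrite -[0]addr0; apply: vgeM; first exact: vge_poly aP'.1.
    exact: vgeW yV.
  by rewrite /cubic_elt -addrA (place_val_dominant a0 rest).2.
exists P; split=> //.
- move=> f; have [->|f0] := eqVneq f 0; first by exists 0; rewrite rmorph0 subr0 vge0.
  rewrite vgeP // => Pf; have [n rf] := Hrep _ f0; move: Pf (rf); rewrite (HP _ _ rf).
  case: (ltrgtP 0 n) => // [n0 _ _|<- _].
    by exists 0; rewrite rmorph0 subr0 vgeP // (HP _ _ rf).
  case=> s [s' [[a [b [c sE]]] [a' [b' [c' s'E]]] Ms Ms' fE]].
  have nQa' : ~~ (Q %| a') by apply/negP => Qa; apply: Ms'; exists a', b', c'.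
  have /Bezout_eq1_coprimepP[[u v] /= uv1] : coprimep Q a'.
    by rewrite irreducible_poly_coprime.
  have s'0 : s' != 0.
    apply: contraNneq nQa'; rewrite s'E => /cubic_elt_eq0[-> _ _]; exact: dvdp0.
  have Is' : cubic_int s' by rewrite s'E; exact: cubic_int_elt.
  have Ps' : P s' = 0 by apply: nM_val => //; rewrite Py.
  exists (a * v); rewrite fE expr0z mul1r.
  have -> : s / s' - ev (a * v) = (s - ev (a * v) * s') / s' by field.
  rewrite -[1]addr0; apply: vgeM; last by rewrite vgeP ?invr_neq0 // place_valV Ps'.
  rewrite sE s'E cubic_eltZ cubic_eltB.
  have -> : a - a * v * a' = a * u * Q by rewrite -[X in X - _](mulr1 a) -uv1; ring.
  have yV : vge P 1 y by rewrite vgeP // Py.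
  rewrite /cubic_elt -addrA; apply: vgeD.
    by apply: (vge1_above aPQ); exact: dvdp_mulIr.
  set b1 := b - _; set c1 := c - _.
  have -> : ev b1 * y + ev c1 * y ^+ 2 = (ev b1 + ev c1 * y) * y by ring.
  rewrite -[1]add0r; apply: vgeM (yV); apply: vgeD; first exact: vge_poly.
  by rewrite -[0]addr0; apply: vgeM; [exact: vge_poly|exact: vgeW yV].
- move=> P' aP'.
  have P'y : 0 < P' y.
    have := place_val_gen P'; rewrite BE rmorphM place_valM ?of_poly_eq0 //; last first.
      by apply: contraNneq nQB' => ->; exact: dvdp0.
    rewrite (place_val_above0 irrQ aP' nQB') addr0 => yQ.
    by rewrite -(pmulr_lgt0 _ (_ : 0 < 3 :> int)) // yQ; exact: aP'.2.
  apply: (place_eq_of_scale P'y) => f f0.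
  have [n rf] := Hrep _ f0; rewrite (HP _ _ rf).
  have [s [s' [Is Is' Ms Ms' fE]]] := rf.
  have nz s1 : ~ M s1 -> s1 != 0.
    by move=> nM; apply/eqP => s10; apply: nM; rewrite s10; exists 0, 0, 0; rewrite cubic_elt_poly rmorph0 dvdp0.
  have s0 := nz _ Ms; have s'0 := nz _ Ms'.
  rewrite fE !place_valM ?invr_neq0 ?mulf_neq0 ?expfz_neq0 //.
  rewrite place_valV (nM_val P' s) // (nM_val P' s') // subr0 addr0.
  case: n {rf fE} => n; first by rewrite -exprnP place_valX.
  by rewrite NegzE -invr_expz place_valV -exprnP place_valX mulrN.
Qed.

(** The coordinates [a], [b] and [c] of [f] are in turn found to be divisible by
    [Q], as residues of [f], of [(f - a) / y] and of [(f - a - b y) / y^2]. *)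
Lemma ramified_int_divr P f : place_above P Q -> P (ev Q) = 3 -> P y = 1 ->
  cubic_int f -> vge P 3 f -> cubic_int (f / ev Q).
Proof.
move=> aP PQ Py [a [b [c ->]]] Pf; apply/cubic_int_divr => //.
have yV : vge P 1 y by rewrite vgeP // Py.
have yV2 : vge P 2 (y ^+ 2) by rewrite vgeP ?expf_neq0 // place_valX Py.
have divy k g : vge P (k + 1) (g * y) -> vge P k g.
  move=> H; rewrite -(mulfK y0 g) -(addrK 1 k); apply: vgeM H _.
  by rewrite vgeP ?invr_neq0 // place_valV Py.
have pV p : vge P 0 (ev p) := vge_poly p aP.1.
have up p : Q %| p -> vge P 3 (ev p) by move=> /(vge_above aP); rewrite PQ.
have Qa : Q %| a.
  rewrite -(vge1_poly irrQ aP).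
  have -> : ev a = cubic_elt a b c - (ev b * y + ev c * y ^+ 2).
    by rewrite /cubic_elt; ring.
  apply: vgeB; first exact: vgeW Pf.
  apply: vgeD; first by rewrite -[1]add0r; exact: vgeM.
  by apply: (@vgeW _ _ _ (0 + 2)) => //; exact: vgeM.
have Pbc : vge P 2 (ev b + ev c * y).
  apply: divy; have -> : (ev b + ev c * y) * y = cubic_elt a b c - ev a.
    by rewrite /cubic_elt; ring.
  by apply: vgeB => //; exact: up.
have Qb : Q %| b.
  rewrite -(vge1_poly irrQ aP); have -> : ev b = ev b + ev c * y - ev c * y by ring.
  by apply: vgeB; [exact: vgeW Pbc|rewrite -[1]add0r; exact: vgeM].
split=> //; rewrite -(vge1_poly irrQ aP); apply: divy.
have -> : ev c * y = ev b + ev c * y - ev b by ring.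
by apply: vgeB => //; apply: vgeW (up _ Qb).
Qed.

End Ramified.
End CubicOrder.

(** * The place at infinity *)

Section PlaceAtInfinity.
Variables (K : fieldType) (L : fieldExtType {fraction {poly K}}) (y : L).
Variable B : {poly K}.
Local Notation ev := (of_poly L).
Local Notation elt := (cubic_elt y).
Hypotheses (hB : ~~ (3 %| (size B).-1)%N) (hy : y ^+ 3 = ev B) (span : cubic_span y).
Implicit Types (P : place L) (a b c d p q : {poly K}) (f g : L).

Let B0 : B != 0.
Proof. by apply: contraNneq hB => ->; rewrite size_poly0. Qed.

Let y0 : y != 0.
Proof. by apply: contra_eqN hy => /eqP->; rewrite expr0n eq_sym of_poly_eq0. Qed.

(** [n] is the order at infinity of the norm of [f]; since infinity is totally
    ramified, this is the value of [f] at the place above it. *)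
Definition infty_rep f (n : int) : Prop := exists a b c d,
  [/\ d != 0, elt a b c != 0, f = elt a b c / ev d &
      n = ((size d).-1 * 3)%N%:Z - (size (cubic_norm B a b c)).-1%:Z].

Let norm_neq0 a b c : elt a b c != 0 -> cubic_norm B a b c != 0.
Proof. by apply: contra_neq => /(cubic_norm_eq0 hB)[-> -> ->]; rewrite cubic_elt_poly rmorph0. Qed.

Let norm_scale p a b c :
  cubic_norm B (p * a) (p * b) (p * c) = p ^+ 3 * cubic_norm B a b c.
Proof. by rewrite /cubic_norm; ring. Qed.

Let infty_rep_neq0 f n : infty_rep f n -> f != 0.
Proof. by case=> a [b [c [d [d0 e0 -> _]]]]; rewrite mulf_neq0 ?invr_neq0 ?of_poly_eq0. Qed.

Let infty_rep_ex f : f != 0 -> exists n, infty_rep f n.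
Proof.
have [a [b [c [d [d0 ->]]]]] := span f; rewrite mulf_eq0 negb_or => /andP[e0 _].
by eexists; exists a, b, c, d.
Qed.

Let infty_rep_uniq f n m : infty_rep f n -> infty_rep f m -> n = m.
Proof.
case=> a [b [c [d [d0 e0 -> ->]]]] [a' [b' [c' [d' [d'0 e'0 E ->]]]]].
have evd0 : ev d != 0 by rewrite of_poly_eq0.
have evd'0 : ev d' != 0 by rewrite of_poly_eq0.
have : elt (d' * a) (d' * b) (d' * c) = elt (d * a') (d * b') (d * c').
  rewrite -!cubic_eltZ; apply: (mulIf (invr_neq0 evd0)); rewrite -mulrA E.
  by field; rewrite evd0.
move=> /(cubic_elt_inj hB hy)[E1 E2 E3].
have : size (d' ^+ 3 * cubic_norm B a b c) = size (d ^+ 3 * cubic_norm B a' b' c').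
  by rewrite -!norm_scale E1 E2 E3.
rewrite !size_expMS ?norm_neq0 // => -[].
by move: (size _).-1 (size _).-1 (size _).-1 (size _).-1; clear; lia.
Qed.

Let infty_repM f g n m : infty_rep f n -> infty_rep g m -> infty_rep (f * g) (n + m).
Proof.
case=> a [b [c [d [d0 e0 -> ->]]]] [a' [b' [c' [d' [d'0 e'0 -> ->]]]]].
exists (a * a' + (b * c' + c * b') * B), (a * b' + b * a' + c * c' * B),
  (a * c' + b * b' + c * a'), (d * d'); split; first by rewrite mulf_neq0.
- by rewrite -(cubic_eltM hy); exact: mulf_neq0.
- by rewrite -(cubic_eltM hy) rmorphM; field; rewrite !of_poly_eq0 d0 d'0.
rewrite -cubic_normM (size_mulS d0 d'0) size_mulS ?norm_neq0 //=.
by move: (size _).-1 (size _).-1 (size _).-1 (size _).-1; clear; lia.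
Qed.

Let val f : int := xget 0 [set n | infty_rep f n]%classic.

Let valE f n : infty_rep f n -> val f = n.
Proof. by move=> r; apply: xget_unique => // m /(infty_rep_uniq r) ->. Qed.

Let val0 : val 0 = 0.
Proof. by apply: xgetPN => n /infty_rep_neq0; rewrite eqxx. Qed.

Let valM f g : f != 0 -> g != 0 -> val (f * g) = val f + val g.
Proof.
move=> /infty_rep_ex[n rn] /infty_rep_ex[m rm].
by rewrite (valE rn) (valE rm) (valE (infty_repM rn rm)).
Qed.

Let size_XD p q (r : {poly K}) n : (size ((p + q) ^+ n * r)%R <=
  maxn (size (p ^+ n * r)%R) (size (q ^+ n * r)%R))%N.
Proof.
have [->|r0] := eqVneq r 0; first by rewrite !mulr0 size_poly0.
have [->|p0] := eqVneq p 0; first by rewrite add0r leq_maxr.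
have [->|q0] := eqVneq q 0; first by rewrite addr0 leq_maxl.
have [->|pq0] := eqVneq (p + q) 0.
  rewrite expr0n; case: n => [|n]; last by rewrite mul0r size_poly0.
  by rewrite !expr0 leq_maxl.
rewrite !size_expMS //.
have : ((size (p + q)%R).-1 * n <= maxn ((size p).-1 * n) ((size q).-1 * n))%N.
  rewrite -maxnMl leq_mul2r; apply/orP; right.
  by move: (size_polyD p q); move: (size (p + q)) (size p) (size q); lia.
move: ((size p).-1 * n)%N ((size q).-1 * n)%N ((size (p + q)%R).-1 * n)%N.
by move: (size r).-1; lia.
Qed.

Let size_cubic_normD a b c a' b' c' :
  (size (cubic_norm B (a + a')%R (b + b')%R (c + c')%R) <=
   maxn (size (cubic_norm B a b c)) (size (cubic_norm B a' b' c')))%N.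
Proof.
rewrite !size_cubic_norm //.
move: (size_XD a a' 1 3) (size_XD b b' B 3) (size_XD c c' (B ^+ 2) 3); rewrite !mulr1.
move: (size ((a + a') ^+ 3)) (size (a ^+ 3)) (size (a' ^+ 3)).
move: (size ((b + b') ^+ 3 * B)) (size (b ^+ 3 * B)) (size (b' ^+ 3 * B)).
move: (size ((c + c') ^+ 3 * B ^+ 2)) (size (c ^+ 3 * B ^+ 2)) (size (c' ^+ 3 * B ^+ 2)).
by lia.
Qed.

Let valD f g : f != 0 -> g != 0 -> f + g != 0 ->
  Order.min (val f) (val g) <= val (f + g).
Proof.
move=> f0 g0 fg0.
have [a [b [c [d [d0 fE]]]]] := span f; have [a' [b' [c' [d' [d'0 gE]]]]] := span g.
have evd0 : ev d != 0 by rewrite of_poly_eq0.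
have evd'0 : ev d' != 0 by rewrite of_poly_eq0.
have {}fE : f = elt (d' * a) (d' * b) (d' * c) / ev (d * d').
  by rewrite fE -cubic_eltZ rmorphM; field; rewrite ?evd0 ?evd'0.
have {}gE : g = elt (d * a') (d * b') (d * c') / ev (d * d').
  by rewrite gE -cubic_eltZ rmorphM; field; rewrite ?evd0 ?evd'0.
have dd0 : d * d' != 0 by rewrite mulf_neq0.
move: fE gE dd0; move: (d' * a) (d' * b) (d' * c) (d * a') (d * b') (d * c') (d * d').
move=> {}a {}b {}c {}a' {}b' {}c' D fE gE D0.
have fgE : f + g = elt (a + a') (b + b') (c + c') / ev D.
  by rewrite fE gE -mulrDl cubic_eltD.
have nz h A : h != 0 -> h = A / ev D -> A != 0.
  by move=> h0 hE; apply: contraNneq h0 => A0; rewrite hE A0 mul0r.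
have e1 := nz _ _ f0 fE; have e2 := nz _ _ g0 gE; have e3 := nz _ _ fg0 fgE.
rewrite (valE (ex_intro _ a (ex_intro _ b (ex_intro _ c (ex_intro _ D (And4 D0 e1 fE erefl)))))).
rewrite (valE (ex_intro _ a' (ex_intro _ b' (ex_intro _ c' (ex_intro _ D (And4 D0 e2 gE erefl)))))).
rewrite (valE (ex_intro _ _ (ex_intro _ _ (ex_intro _ _ (ex_intro _ D (And4 D0 e3 fgE erefl)))))).
have := size_cubic_normD a b c a' b' c'.
move: (size (cubic_norm _ _ _ _)) (size (cubic_norm _ _ _ _)) (size (cubic_norm _ _ _ _)).
move=> s1 s2 s3; rewrite leq_max ge_min => /orP[H|H]; apply/orP; [left|right].
  by move: (size D).-1 H; clear; lia.
by move: (size D).-1 H; clear; lia.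
Qed.

Let val_poly p : p != 0 -> infty_rep (ev p) (- ((size p).-1 * 3)%N%:Z).
Proof.
move=> p0; exists p, 0, 0, 1; rewrite cubic_elt_poly oner_neq0 of_poly_eq0 p0.
split=> //; first by rewrite rmorph1 divr1.
by rewrite /cubic_norm size_poly1 !(expr0n, mul0r, mulr0, mul0rn, addr0, subr0) size_expS //= sub0r.
Qed.

Let val_const k : val (of_const L k) = 0.
Proof.
have [->|k0] := eqVneq k 0; first by rewrite /of_const rmorph0 val0.
apply: valE; have := @val_poly k%:P.
by rewrite polyC_eq0 size_polyC k0 mul0n oppr0; apply.
Qed.

(* With [d = deg B], the value of [y^i / x^j] is [3 j - i d]; take [i] such that
   [i d = -1] modulo 3. *)
Let val_unif : exists u, val u = 1.
Proof.
have Xj0 j : 'X^j != 0 :> {poly K} by rewrite -size_poly_gt0 size_polyXn.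
have : ((size B).-1 %% 3 = 1 \/ (size B).-1 %% 3 = 2)%N by lia.
case=> Bm.
  pose j := ((size B).-1 %/ 3 * 2).+1.
  exists (y ^+ 2 / ev 'X^j); apply: valE; exists 0, 0, 1, 'X^j.
  have E : elt 0 0 1 = y ^+ 2 by rewrite /cubic_elt !rmorph0 rmorph1; ring.
  rewrite E size_polyXn; split; [exact: Xj0|exact: expf_neq0|by []|].
  rewrite /cubic_norm !(expr0n, expr1n, mul0r, mulr0, mul1r, mul0rn, add0r, addr0, subr0) /=.
  by rewrite size_expS // /j; move: (size B).-1 Bm; clear; lia.
pose j := ((size B).-1 %/ 3).+1.
exists (y / ev 'X^j); apply: valE; exists 0, 1, 0, 'X^j.
rewrite -cubic_gen_elt size_polyXn; split; [exact: Xj0|exact: y0|by []|].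
rewrite /cubic_norm !(expr0n, expr1n, mul0r, mulr0, mul1r, mul0rn, add0r, addr0, subr0) /=.
by rewrite /j; move: (size B).-1 Bm; clear; lia.
Qed.

Let Pinf := Place val0 valM valD val_const val_unif.

Let Pinf_poly p : p != 0 -> Pinf (ev p) = - ((size p).-1 * 3)%N%:Z.
Proof. by move=> p0; apply: valE; exact: val_poly. Qed.

Let Pinf_int f : cubic_int y f -> f != 0 -> Pinf f <= 0.
Proof.
case=> a [b [c ->]] f0.
suff -> : Pinf (elt a b c) = - (size (cubic_norm B a b c)).-1%:Z by lia.
apply: valE; exists a, b, c, 1; rewrite oner_neq0 f0 rmorph1 divr1 size_poly1 mul0n sub0r.
by split.
Qed.

Let Pinf_residue f : vge Pinf 0 f -> exists k, vge Pinf 1 (f - of_const L k).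
Proof.
have [->|f0] := eqVneq f 0; first by exists 0; rewrite /of_const rmorph0 subr0 vge0.
have [n rf] := infty_rep_ex f0; rewrite vgeP // [Pinf f](valE rf).
have [a [b [c [d [d0 e0 fE ->]]]]] := rf => n0.
have s0 : (size (cubic_norm B a b c) <= size (d ^+ 3))%N.
  move: n0 (norm_neq0 e0); rewrite size_expS // -size_poly_gt0.
  by move: (size (cubic_norm _ _ _ _)) (size d).-1; clear; lia.
move: s0; rewrite size_cubic_norm // !geq_max => /andP[/andP[sa sb] sc].
pose k := a`_(size d).-1 / lead_coef d; exists k.
have fkE : f - of_const L k = elt (a - k *: d) b c / ev d.
  rewrite fE -mul_polyC; have -> : elt (a - k%:P * d) b c = elt a b c - of_const L k * ev d.
    by rewrite /cubic_elt rmorphB rmorphM; ring.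
  by field; rewrite of_poly_eq0.
have [E|e1] := eqVneq (elt (a - k *: d) b c) 0; first by rewrite fkE E mul0r vge0.
have evd0 : ev d != 0 by rewrite of_poly_eq0.
have fk0 : f - of_const L k != 0 by rewrite fkE mulf_neq0 ?invr_neq0.
rewrite vgeP // [Pinf _](valE (ex_intro _ _ (ex_intro _ _ (ex_intro _ _
  (ex_intro _ d (And4 d0 e1 fkE erefl)))))).
suff : (size (cubic_norm B (a - k *: d)%R b c) < size (d ^+ 3)%R)%N.
  move: (norm_neq0 e1); rewrite size_expS // -size_poly_gt0.
  by move: (size (cubic_norm _ _ _ _)) (size d).-1; clear; lia.
rewrite size_cubic_norm // !gtn_max; move: sa sb sc; rewrite (size_expS _ d0) => sa sb sc.
apply/andP; split; first (apply/andP; split).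
- have [->|a10] := eqVneq (a - k *: d) 0; first by rewrite expr0n size_poly0.
  have sd : (size (a - k *: d)%R < size d)%N.
    have H : (size (a - k *: d)%R <= size d)%N.
      rewrite (leq_trans (size_polyD _ _)) // geq_max size_polyN (leq_trans (size_scale_leq _ _)) // andbT.
      have [->|a0] := eqVneq a 0; first by rewrite size_poly0.
      move: sa; rewrite (size_expS _ a0); move: a0 d0; rewrite -!size_poly_gt0.
      by move: (size a) (size d); clear; lia.
    rewrite ltn_neqAle H andbT; apply: contraNneq a10 => E.
    by rewrite -lead_coef_eq0 lead_coefE E coefB coefZ divfK ?subrr // lead_coef_eq0.
  rewrite (size_expS _ a10); move: sd a10; rewrite -size_poly_gt0.
  by move: (size (a - _)) (size d); clear; lia.
- have [->|b0] := eqVneq b 0; first by rewrite expr0n mul0r size_poly0.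
  move: sb hB; rewrite size_expMS //.
  by move: (size d).-1 (size b).-1 (size B).-1; clear; lia.
- have [->|c0] := eqVneq c 0; first by rewrite expr0n mul0r size_poly0.
  move: sc hB; rewrite size_expMS ?expf_neq0 // size_expS //.
  by move: (size d).-1 (size c).-1 (size B).-1; clear; lia.
Qed.

(* For the multiple [e * Pinf] of [Pinf] which agrees with [P] on polynomials and
   on [y], the values of the three terms of an element only give [e * Pinf <= P];
   at the inverse of the element, this is the opposite inequality. *)
Let Pinf_uniq P : P (ev 'X) < 0 -> P = Pinf.
Proof.
move=> PX; have [k [k0 PXk]] : exists k : int, 0 < k /\ P (ev 'X) = - k.
  by exists (- P (ev 'X)); rewrite oppr_gt0 opprK.
have Ppoly p : p != 0 -> P (ev p) = - k * (size p).-1%:Z := place_val_poly_lead k0 PXk.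
have Py := place_val_gen hy P; rewrite Ppoly // in Py.
have [e [e0 kE]] : exists e, 0 < e /\ k = e * 3.
  have: (3 %| k * (size B).-1%:Z)%Z.
    by apply/dvdzP; exists (- P y); rewrite mulNr Py mulNr opprK.
  rewrite Gauss_dvdzl; last by rewrite coprimezE /= prime_coprime.
  by case/dvdzP => e kE; exists e; split=> //; lia.
have {}Py : P y = - e * (size B).-1%:Z.
  by apply: (@mulIf _ (3 : int)) => //; rewrite Py kE; ring.
have le_P f : f != 0 -> e * Pinf f <= P f.
  move=> f0; have [n rf] := infty_rep_ex f0; rewrite [Pinf f](valE rf).
  have [a [b [c [d [d0 e1 -> ->]]]]] := rf.
  have evd0 : ev d != 0 by rewrite of_poly_eq0.
  rewrite place_valM ?invr_neq0 // place_valV Ppoly // kE.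
  suff : vge P (- e * (size (cubic_norm B a b c)).-1%:Z) (elt a b c).
    by rewrite vgeP //; move: (size d).-1 (size _).-1 (P _) => s1 s2 v; lia.
  have sN := norm_neq0 e1; have sN3 := size_cubic_norm a b c hB.
  have term p j : p != 0 -> (3 * (size p).-1 + j * (size B).-1 <= (size (cubic_norm B a b c)).-1)%N ->
      vge P (- e * (size (cubic_norm B a b c)).-1%:Z) (ev p * y ^+ j).
    move=> p0 H; have evp0 : ev p != 0 by rewrite of_poly_eq0.
    rewrite vgeP ?mulf_neq0 ?expf_neq0 // place_valM ?expf_neq0 // place_valX Ppoly // Py kE.
    by move: (size p).-1 (size B).-1 (size _).-1 H => s1 s2 s3 H; clear -H e0; nia.
  rewrite /cubic_elt; apply: vgeD; first apply: vgeD.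
  + have [->|a0] := eqVneq a 0; first by rewrite rmorph0 vge0.
    rewrite -[ev a]mulr1 -(expr0 y); apply: term => //.
    move: sN3; rewrite size_expS //; move: (size (b ^+ 3 * B)) => s1.
    move: (size (c ^+ 3 * B ^+ 2)) => s2.
    by move: (size a).-1 (size B).-1 (size _) => s3 s4 s5; clear; lia.
  + have [->|b0] := eqVneq b 0; first by rewrite rmorph0 mul0r vge0.
    rewrite -[y in ev b * y]expr1; apply: term => //.
    move: sN3; rewrite size_expMS //; move: (size (a ^+ 3)) => s1.
    move: (size (c ^+ 3 * B ^+ 2)) => s2.
    by move: (size b).-1 (size B).-1 (size _) => s3 s4 s5; clear; lia.
  + have [->|c0] := eqVneq c 0; first by rewrite rmorph0 mul0r vge0.
    apply: term => //.
    move: sN3; rewrite [size (c ^+ 3 * _)]size_expMS ?expf_neq0 // (@size_expS _ B) //.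
    move: (size (a ^+ 3)) (size (b ^+ 3 * B)) => s1 s2.
    by move: (size c).-1 (size B).-1 (size _) => s3 s4 s5; clear; lia.
apply: (place_eq_of_scale e0) => f f0; apply/eqP; rewrite eq_le le_P // andbT.
by have := le_P _ (invr_neq0 f0); rewrite !place_valV; lia.
Qed.

Lemma infinite_place : exists P : place L,
  [/\ forall p, p != 0 -> P (ev p) = - ((size p).-1 * 3)%N%:Z,
      forall f, cubic_int y f -> f != 0 -> P f <= 0,
      forall f, vge P 0 f -> exists k, vge P 1 (f - of_const L k) &
      forall P', P' (ev 'X) < 0 -> P' = P].
Proof. by exists Pinf. Qed.

End PlaceAtInfinity.

(** * Unramified primes, and elements without poles *)

Section UnramifiedPlace.
Variables (K : finFieldType) (L : fieldExtType {fraction {poly K}}) (y : L).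
Variable B : {poly K}.
Local Notation ev := (of_poly L).
Local Notation elt := (cubic_elt y).
Local Notation cint := (cubic_int y).
Hypotheses (hB : ~~ (3 %| (size B).-1)%N) (hy : y ^+ 3 = ev B) (span : cubic_span y).
Hypothesis ch3 : 3%:R != 0 :> K.
Implicit Types (P : place L) (a b c d p q : {poly K}) (f g : L).

Section AtQ.
Variable Q : {poly K}.
Hypotheses (irrQ : irreducible_poly Q) (nQB : ~~ (Q %| B)).

Let divQ f := cint (f / ev Q).

Let Q0 : Q != 0 := irredp_neq0 irrQ.

Let evQ0 : ev Q != 0. Proof. by rewrite of_poly_eq0. Qed.

Let divQ_mul f g : divQ f -> cint g -> divQ (f * g).
Proof. by rewrite /divQ mulrAC; exact: (cubic_intM hy). Qed.

Let divQ_sqr f : cint f -> divQ (f ^+ 2) -> divQ f.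
Proof.
case=> a [b [c ->]]; rewrite /divQ expr2 (cubic_eltM hy).
move=> /(cubic_int_divr hB hy _ _ _ Q0)[Qa Qb Qc]; apply/(cubic_int_divr hB hy _ _ _ Q0).
apply: (cubic_square_coord irrQ nQB ch3).
- by move: Qa; congr (_ %| _); ring.
- by move: Qb; congr (_ %| _); ring.
- by move: Qc; congr (_ %| _); ring.
Qed.

Let divQ_exp f n : cint f -> divQ (f ^+ n.+1) -> divQ f.
Proof.
move=> If; elim: n => [|n IH]; rewrite ?expr1 // => H; apply: IH.
apply: divQ_sqr; first exact: (cubic_intX hy).
by rewrite -exprM mulnC mul2n -addnn addSnnS exprD mulrC; apply: divQ_mul H _; exact: (cubic_intX hy).
Qed.

Let divQ_poly p f : ~~ (Q %| p) -> cint f -> divQ (ev p * f) -> divQ f.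
Proof.
move=> nQp [a [b [c ->]]]; rewrite /divQ cubic_eltZ.
move=> /(cubic_int_divr hB hy _ _ _ Q0)[Qa Qb Qc]; apply/(cubic_int_divr hB hy _ _ _ Q0).
by split; [move: Qa|move: Qb|move: Qc] => /(irredp_dvdM irrQ); rewrite (negPf nQp).
Qed.

Let n := (size Q).-1.

(* Representatives of the residue classes modulo [Q]. *)
Let T := ('rV[K]_n * 'rV[K]_n * 'rV[K]_n)%type.

Let rep (t : T) := elt (rVpoly t.1.1) (rVpoly t.1.2) (rVpoly t.2).

Let rep_ex f : cint f -> exists t, divQ (f - rep t).
Proof.
have szQ p : (size (p %% Q)%R <= n)%N.
  by rewrite -ltnS prednK ?size_poly_gt0 // ltn_modp.
case=> a [b [c ->]]; exists (poly_rV (a %% Q), poly_rV (b %% Q), poly_rV (c %% Q)).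
rewrite /rep /= !poly_rV_K // cubic_eltB; apply/(cubic_int_divr hB hy _ _ _ Q0).
have H p : Q %| p - p %% Q by rewrite {1}(divp_eq p Q) addrK dvdp_mulIr.
by split; exact: H.
Qed.

Variable G : L.
Hypotheses (intG : cint G) (nQG : ~ divQ G).

Let ann (e : L) : {set T} := finset (fun t : T => `[< divQ (e * rep t) >]).

(* Among the multiples of [G] not divisible by [Q], take [e] with the largest
   annihilator modulo [Q]; it exists because there are finitely many residues. *)
Let annihilator_max : exists e,
  [/\ cint e, ~ divQ e, divQ (e * G) -> divQ (e ^+ 2) &
      forall f, cint f -> ~ divQ (e * f) -> ann (e * f) = ann e].
Proof.
pose Pn k := `[< exists s, [/\ cint s, ~ divQ (G * s) & #|ann (G * s)| = k] >].
have ex : exists k, Pn k.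
  exists #|ann (G * 1)|; apply/asboolP; exists 1; split=> //; last by rewrite mulr1.
  by rewrite -(rmorph1 ev); exact: cubic_int_poly.
have ub k : Pn k -> (k <= #|{: T}|)%N by move=> /asboolP[s [_ _ <-]]; exact: max_card.
case: (ex_maxnP ex ub) => k /asboolP[s [Is ns <-]] max_k.
exists (G * s); split=> //; first exact: (cubic_intM hy).
  by rewrite expr2 [_ * (G * s)]mulrA => H; exact: divQ_mul.
move=> f If nf; apply/esym/eqP; rewrite eqEcard; apply/andP; split.
  apply/fintype.subsetP => t; rewrite !finset.inE => /asboolP H; apply/asboolP.
  by have := divQ_mul H If; rewrite -[_ * f]mulrA [rep t * f]mulrC mulrA.
apply: max_k; apply/asboolP; exists (s * f); rewrite mulrA; split=> //.
exact: (cubic_intM hy).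
Qed.

(** For a multiple [e] of [G] with maximal annihilator modulo [Q], this
    annihilator is a prime ideal. It contains neither [e] nor [G], as the order
    modulo [Q] is reduced; and [e] multiplies it into the multiples of [Q], which
    is thus a uniformizer at this prime. *)
Lemma unramified_place : exists P : place L,
  [/\ 0 <= P (ev 'X), P (ev Q) = 1 & P G = 0].
Proof.
have [e [Ie ne eG max_e]] := annihilator_max.
have int1 : cint 1 by rewrite -(rmorph1 ev); exact: cubic_int_poly.
pose M f := divQ (e * f).
have M_mul f g : cint f -> cint g -> M f -> M (f * g).
  by move=> _ Ig Mf; rewrite /M mulrA; exact: divQ_mul.
have M_prime f g : cint f -> cint g -> M (f * g) -> M f \/ M g.
  move=> If Ig Mfg; have [Mg|nMg] := pselect (M g); [by right|left].
  have [t ft] := rep_ex If.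
  have add h k : divQ h -> divQ k -> divQ (h + k).
    by rewrite /divQ mulrDl; exact: cubic_intD.
  have opp h : divQ h -> divQ (- h).
    by move=> Hh; rewrite -mulN1r mulrC; apply: divQ_mul => //;
      rewrite -(rmorph1 ev) -rmorphN; exact: cubic_int_poly.
  have tE h : cint h -> divQ (h * f) <-> divQ (h * rep t).
    move=> Ih; have Hh : divQ (h * (f - rep t)) by rewrite mulrC; exact: divQ_mul.
    split=> H.
      have -> : h * rep t = h * f + - (h * (f - rep t)) by ring.
      by apply: add => //; exact: opp.
    have -> : h * f = h * rep t + h * (f - rep t) by ring.
    exact: add.
  apply/(tE _ Ie)/asboolP; have := max_e _ Ig nMg => /setP/(_ t).
  rewrite !finset.inE => <-; apply/asboolP/tE; first exact: (cubic_intM hy).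
  by rewrite -mulrA [g * f]mulrC.
have ne2 : ~ M e by move=> H; apply: ne; apply: divQ_sqr => //; rewrite expr2.
have sep f : cint f -> f != 0 -> exists k, ~ cint (e ^+ k * f / ev Q ^+ k).
  move=> If f0; have [g [p [Ig p0 fg]]] := cubic_int_norm hB hy If f0.
  have [k [q [pE nQq]]] := irredp_factor irrQ p0; exists k.+1 => H.
  apply: ne; apply: (@divQ_exp _ k) => //.
  apply: (divQ_poly nQq); first exact: (cubic_intX hy).
  have := cubic_intM hy H Ig; congr (cint _).
  have -> : e ^+ k.+1 * f / ev Q ^+ k.+1 * g = e ^+ k.+1 * (f * g) / ev Q ^+ k.+1.
    by ring.
  rewrite fg pE rmorphM rmorphXn /= [ev Q ^+ k.+1]exprS; field.
  by rewrite evQ0 expf_neq0.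
have MQ : M (ev Q) by rewrite /M /divQ mulfK.
have [P [HP HR]] := @place_of_prime _ L cint M (ev Q) e (cubic_int_const _)
  (@cubic_intD _ _ _) (@cubic_intM _ _ _ _ hy) (cubic_int_frac span) M_mul M_prime
  (cubic_int_poly _ _) MQ evQ0 Ie ne2 (fun f _ Mf => Mf) sep.
have nM1 : ~ M 1 by rewrite /M mulr1.
exists P; split.
- by rewrite -(@vgeP _ _ P 0) ?of_poly_eq0 ?polyX_eq0 //; apply: HR; exact: cubic_int_poly.
- by apply: HP; exists 1, 1; split=> //; rewrite mulr1 divr1.
apply: HP; exists G, 1; split=> //; last by rewrite divr1 mul1r.
by move=> /eG H; apply: ne2; rewrite /M -expr2.
Qed.

End AtQ.

Hypothesis sqf : forall Q, irreducible_poly Q -> Q %| B -> ~~ (Q ^+ 2 %| B).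

(** The irreducible factors [Q] of a common denominator cancel one after the
    other: a numerator not divisible by [Q] would make some place above [Q] a
    pole of [f]. *)
Lemma cubic_int_of_places f :
  (forall P, 0 <= P (ev 'X) -> vge P 0 f) -> cint f.
Proof.
have [a [b [c [d [d0 fE]]]]] := span f; rewrite fE => {f fE}.
elim: {d}(size d) {-2}d (leqnn (size d)) d0 a b c => [|n IH] d.
  by rewrite leqn0 size_poly_eq0 => ->.
move=> dn d0 a b c Hf; have evd0 : ev d != 0 by rewrite of_poly_eq0.
have [d1|d1] := leqP (size d) 1.
  have /size_poly1P[k k0 dE] : size d == 1%N by rewrite eqn_leq d1 size_poly_gt0.
  have -> : elt a b c / ev d = elt a b c * of_const L k^-1.
    apply: (mulIf evd0); rewrite divfK // -mulrA dE -rmorphM -polyCM mulVf //.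
    by rewrite rmorph1 mulr1.
  by apply: (cubic_intM hy); [exact: cubic_int_elt|exact: cubic_int_const].
have [Q irrQ /dvdpP[d' dE]] := exists_irredp d1.
have Q0 := irredp_neq0 irrQ; have evQ0 : ev Q != 0 by rewrite of_poly_eq0.
have d'0 : d' != 0 by apply: contraNneq d0 => d'0; rewrite dE d'0 mul0r.
have evd'0 : ev d' != 0 by rewrite of_poly_eq0.
have eltE : elt a b c = elt a b c / ev d * ev d by rewrite divfK.
have [a' [b' [c' E]]] : cint (elt a b c / ev Q).
  have [QB|nQB] := boolP (Q %| B).
    have [B' BE] := dvdpP _ _ QB; rewrite mulrC in BE.
    have nQB' : ~~ (Q %| B').
      by apply: contra (sqf irrQ QB); rewrite BE expr2 => H; exact: dvdp_mul _ H.
    have [P [aP PQ Py _ _]] := ramified_place hB hy span irrQ BE nQB'.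
    apply: (ramified_int_divr hB hy irrQ aP PQ Py); first exact: cubic_int_elt.
    rewrite eltE -[3]add0r; apply: vgeM; first exact: Hf aP.1.
    by rewrite -PQ; apply: (vge_above aP); rewrite dE dvdp_mulIr.
  apply: contrapT => nQ.
  have [P [PX PQ PG]] := unramified_place irrQ nQB (cubic_int_elt _ _ _ _) nQ.
  have e0 : elt a b c != 0.
    by apply/eqP => e0; apply: nQ; rewrite e0 mul0r; exists 0, 0, 0; rewrite cubic_elt_poly rmorph0.
  have := Hf P PX; rewrite vgeP ?mulf_neq0 ?invr_neq0 // place_valM ?invr_neq0 //.
  rewrite place_valV PG dE rmorphM /= place_valM // PQ.
  by move: (vge_poly d' PX); rewrite vgeP //; move: (P (ev d')); clear; lia.
have E' : elt a b c / ev d = elt a' b' c' / ev d'.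
  by rewrite -E dE rmorphM; field; rewrite evd'0.
rewrite E' in Hf *; apply: IH Hf => //.
move: dn; rewrite dE size_mul //; case: irrQ => + _; rewrite -size_poly_gt0 in d'0.
by move: (size Q) (size d') d'0; clear; lia.
Qed.

(** The difference of [f] and its residue at infinity has no poles, so it is
    integral; but it vanishes at infinity, where nonzero integral elements have
    value at most 0. *)
Lemma constant_of_places f : (forall P, vge P 0 f) -> exists k, f = of_const L k.
Proof.
move=> Hf; have [P [_ Pint Pres _]] := infinite_place hB hy span.
have [k Hk] := Pres f (Hf P); exists k; apply/eqP; rewrite -subr_eq0; apply/negPn/negP => fk0.
have : cint (f - of_const L k).
  apply: cubic_int_of_places => P' _; apply: vgeB (Hf P') (vge_const _ _).
move=> /Pint/(_ fk0); move: Hk; rewrite vgeP //.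
by move: (P (f - _)); clear; lia.
Qed.

End UnramifiedPlace.

(** * Counting cosets *)

Section QuotientCard.
Variables (V : zmodType) (N H : V -> Prop) (m n h : nat) (D : 'I_n -> V).
Hypotheses (N0 : N 0) (N_opp : forall u, N u -> N (- u))
  (N_add : forall u v, N u -> N v -> N (u + v)).
Hypotheses (H_add : forall u v, H u -> H v -> H (u + v)) (H0 : H 0).
Hypotheses (m_gt0 : (0 < m)%N) (H_D : forall j, H (D j))
  (N_D : forall j, N (D j *+ m))
  (N_sum : forall a : 'I_n -> nat, N (\sum_j D j *+ a j) -> forall j, (m %| a j)%N).
Let cl u := [set v | N (v - u)]%classic.
Hypothesis card_h : (cl @` [set u | H u] #= `I_h)%card.

Let comb (a : 'I_n -> nat) := \sum_j D j *+ a j.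

Let combD a b : comb (fun j => a j + b j)%N = comb a + comb b.
Proof. by rewrite -big_split; apply: eq_bigr => j _; rewrite mulrnDr. Qed.

Let N_sumr (F : 'I_n -> V) : (forall j, N (F j)) -> N (\sum_j F j).
Proof. by move=> NF; apply: (big_ind N). Qed.

Let H_comb a : H (comb a).
Proof.
apply: (big_ind H) => // j _; elim: (a j) => [|k IH]; first by rewrite mulr0n.
by rewrite mulrS; exact: H_add.
Qed.

Let comb_eq a b : (forall j, a j = b j %[mod m]) -> N (comb a - comb b).
Proof.
have N_mod c : N (comb c - comb (fun j => c j %% m)%N).
  rewrite -sumrB; apply: N_sumr => j; rewrite -mulrnBr ?leq_mod //.
  rewrite {1}(divn_eq (c j) m) addnK mulnC mulrnA.
  elim: (c j %/ m)%N => [|k IH]; first by rewrite mulr0n.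
  by rewrite mulrS; apply: N_add.
move=> ab; have -> : comb a - comb b =
    comb a - comb (fun j => a j %% m)%N - (comb b - comb (fun j => b j %% m)%N).
  have -> : comb (fun j => b j %% m)%N = comb (fun j => a j %% m)%N.
    by apply: eq_bigr => j _; rewrite ab.
  by rewrite opprB addrA subrK.
by apply: N_add => //; exact: N_opp.
Qed.

Let reps : exists c : 'I_h -> V, [/\ forall i, H (c i),
  forall u, H u -> exists i, N (u - c i) & forall i j, N (c i - c j) -> i = j].
Proof.
have cl_eq u v : N (u - v) -> cl u = cl v.
  move=> Nuv; apply/seteqP; split=> w; rewrite /cl /= => Nw.
    have -> : w - v = (w - u) + (u - v) by rewrite addrA subrK.
    exact: N_add.
  have -> : w - u = (w - v) - (u - v) by rewrite opprB addrA subrK.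
  by apply: N_add => //; exact: N_opp.
have [f [f_fun f_inj f_surj]] := card_set_bijP card_h.
have pre (i : 'I_h) : exists u, H u /\ f (cl u) = i.
  by have [_ [u Hu <-] fE] := f_surj i (ltn_ord i); exists u.
exists (fun i => projT1 (cid (pre i))); split=> [i|u Hu|i j].
- by case: cid => u [].
- have lt_h : (f (cl u) < h)%N by apply: f_fun; exists u.
  exists (Ordinal lt_h); case: cid => v /= [Hv E].
  have /seteqP[/(_ u) + _] : cl u = cl v.
    by apply: f_inj; rewrite ?inE; [exists u|exists v|].
  by apply; rewrite /cl /= subrr.
case: cid => u [Hu fu]; case: cid => v [Hv fv] /= /cl_eq E.
by apply: ord_inj; rewrite -fu -fv E.
Qed.

(** Lagrange for the quotient of [H] by [N], given by its cosets: the classes of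
    the [D j] generate a subgroup isomorphic to [(Z/m)^n], whose cosets
    partition the quotient. *)
Lemma dvdn_card_quotient : (m ^ n %| h)%N.
Proof.
have [c [Hc c_ex c_inj]] := reps.
pose R i j := `[< exists a, N (c j - c i - comb a) >].
have R_equiv : {in [set: 'I_h] & &, equivalence_rel R}.
  have Rrefl i : R i i.
    apply/asboolP; exists (fun=> 0%N); rewrite subrr sub0r; apply: N_opp.
    by rewrite /comb big1.
  have Rtrans i j k : R i j -> R j k -> R i k.
    move=> /asboolP[a Na] /asboolP[b Nb]; apply/asboolP; exists (fun j => a j + b j)%N.
    have -> : c k - c i - comb (fun j => a j + b j)%N
        = (c j - c i - comb a) + (c k - c j - comb b).
      by apply/esym; rewrite combD addrACA [X in X + _]addrC [X in X + _]addrA subrK -opprD.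
    exact: N_add.
  have Rsym i j : R i j -> R j i.
    move=> /asboolP[a Na]; apply/asboolP; exists (fun j => m.-1 * a j)%N.
    have -> : c i - c j - comb (fun j => m.-1 * a j)%N
        = - (c j - c i - comb a) - (comb a + comb (fun j => m.-1 * a j)%N).
      by apply/esym; rewrite !opprB opprD addrA [comb a + _]addrC addrK.
    apply: N_add; apply: N_opp => //; rewrite -combD -[X in N X]subr0.
    have -> : 0 = comb (fun=> 0%N) by rewrite /comb big1.
    apply: comb_eq => k; by rewrite -mulSn prednK // modnMr mod0n.
  move=> i j k _ _ _; split=> // Rij; apply/idP/idP; last exact: Rtrans.
  exact: Rtrans (Rsym _ _ Rij).
have part := equivalence_partitionP R_equiv.
suff block A : A \in equivalence_partition R [set: 'I_h] -> #|A| = (m ^ n)%N.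
  have := card_uniform_partition block part; rewrite cardsT card_ord => ->.
  exact: dvdn_mull.
case/imsetP => i _ ->.
have Fex (a : {ffun 'I_n -> 'I_m}) : exists j, N (c i + comb (fun k => a k) - c j).
  by apply: c_ex; apply: H_add.
pose F a := projT1 (cid (Fex a)).
have FP (a : {ffun 'I_n -> 'I_m}) : N (c i + comb (fun k => a k) - c (F a)) := projT2 (cid (Fex a)).
have F_inj : injective F.
  move=> a b E; apply/ffunP => j; apply/val_inj => /=.
  have: N (comb (fun k => a k + (m - b k))%N).
    have -> : comb (fun k => a k + (m - b k))%N =
        (c i + comb (fun k => a k) - c (F a)) - (c i + comb (fun k => b k) - c (F b))
        + (comb (fun k => b k + (m - b k))%N - comb (fun=> 0%N)).
      apply/esym; rewrite !combD E [comb (fun=> 0%N)]big1 // subr0 [- (_ - c _)]opprB.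
      by rewrite [X in X + _]addrA subrK opprD [X in X + _]addrACA subrr add0r addrA subrK.
    apply: N_add; first by apply: N_add => //; exact: N_opp.
    by apply: comb_eq => k; rewrite subnKC ?modnn ?mod0n // ltnW.
  move=> /N_sum/(_ j) /=; have := ltn_ord (a j); have := ltn_ord (b j).
  move: (a j : nat) (b j : nat) => k l lm km /dvdnP[[|[|q]]]; clear -lm km; [lia|lia|nia].
rewrite -(card_ord m) -(card_ord n) -card_ffun -(card_imset _ F_inj).
apply/eq_card => j; rewrite !inE /=; apply/idP/imsetP => [/asboolP[a Na]|[a _ ->]].
  exists [ffun k => Ordinal (ltn_pmod (a k) m_gt0)] => //.
  apply: c_inj; set a' := finfun _.
  have -> : c j - c (F a') = (c j - c i - comb a) + (c i + comb (fun k => a' k) - c (F a'))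
      + (comb a - comb (fun k => a' k)).
    apply/esym; rewrite addrAC [X in X + _]addrA subrK [c i + _]addrC -[in X in _ + X]addrA.
    by rewrite addrA subrK addrA subrK.
  by apply: N_add; [exact: N_add|apply: comb_eq => k; rewrite ffunE modn_mod].
apply/asboolP; exists (fun k => a k : nat).
have -> : c (F a) - c i - comb (fun k => a k) = - (c i + comb (fun k => a k) - c (F a)).
  by apply/esym; rewrite opprB opprD addrA.
exact: N_opp.
Qed.

End QuotientCard.

(** * The ramified divisors and the class number *)

Lemma fraction_tofrac (R : idomainType) (u : {fraction R}) :
  exists n d : R, d != 0 /\ u = tofrac n / tofrac d.
Proof.
elim/quotW: u => x; exists (frac x).1, (frac x).2; rewrite denom_ratioP; split=> //.
apply: (canRL (mulfK _)); first by rewrite tofrac_eq0 denom_ratioP.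
unlock tofrac; rewrite -[LHS]FracField.pi_mul; apply/eqmodP => /=.
rewrite FracField.equivfE /FracField.mulf /= !numden_Ratio ?mulf_neq0 ?oner_neq0 ?denom_ratioP //.
by rewrite !mulr1 mulrC.
Qed.

Lemma cubic_span_gen (K : fieldType) (L : fieldExtType {fraction {poly K}}) (y : L) :
  \dim {:L} = 3%N -> <<1; y>>%VS = {:L}%VS -> cubic_span y.
Proof.
move=> dimL gen f.
have deg3 : adjoin_degree 1 y = 3%N.
  by rewrite -[1%VS]/(asval 1%AS) adjoin_degreeE gen dimL dimv1 divn1.
have fy : (Fadjoin_poly 1 y f).[y] = f.
  by apply: (@Fadjoin_poly_eq _ _ 1%AS); rewrite gen memvf.
have coefE i : exists n d : {poly K},
    d != 0 /\ (Fadjoin_poly 1 y f)`_i = of_poly L n / of_poly L d.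
  have /polyOverP/(_ i) := Fadjoin_polyOver 1%VS y f.
  case/vlineP => u ->; have [n [d [d0 ->]]] := fraction_tofrac u.
  exists n, d; split=> //; apply: (canRL (mulfK _)); first by rewrite of_poly_eq0.
  by rewrite /of_poly -scalerAl mul1r scalerA divfK // tofrac_eq0.
have [n0 [d0 [d00 E0]]] := coefE 0%N; have [n1 [d1 [d10 E1]]] := coefE 1%N.
have [n2 [d2 [d20 E2]]] := coefE 2%N.
exists (n0 * d1 * d2), (n1 * d0 * d2), (n2 * d0 * d1), (d0 * d1 * d2).
split; first by rewrite !mulf_neq0.
rewrite -{1}fy (@horner_coef_wide _ 3) -?deg3 ?size_Fadjoin_poly // deg3.
rewrite !big_ord_recr big_ord0 /= E0 E1 E2 /cubic_elt !rmorphM /=.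
by field; rewrite !of_poly_eq0 d00 d10 d20.
Qed.

Lemma divisor_degreeB (K : fieldType) (L : fieldExtType {fraction {poly K}})
  (D E : divisor L) : divisor_degree (D - E) = divisor_degree D - divisor_degree E.
Proof. by rewrite /divisor_degree lift_is_additive. Qed.

Lemma divisor_degree0 (K : fieldType) (L : fieldExtType {fraction {poly K}}) :
  divisor_degree (0 : divisor L) = 0.
Proof. by rewrite -(subrr 0) divisor_degreeB subrr. Qed.

Lemma divisor_degreeD (K : fieldType) (L : fieldExtType {fraction {poly K}})
  (D E : divisor L) : divisor_degree (D + E) = divisor_degree D + divisor_degree E.
Proof.
by rewrite -[in LHS](opprK E) divisor_degreeB -[- E]sub0r divisor_degreeB divisor_degree0
  sub0r opprK.
Qed.

Section Principal.
Variables (K : fieldType) (L : fieldExtType {fraction {poly K}}).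

Lemma principal0 : principal (0 : divisor L).
Proof. by exists 1; rewrite ?oner_neq0 // => P; rewrite coeff0 place_val1. Qed.

Lemma principalN (D : divisor L) : principal D -> principal (- D).
Proof.
by case=> f f0 Hf; exists f^-1; rewrite ?invr_neq0 // => P; rewrite coeffN Hf place_valV.
Qed.

Lemma principalD (D E : divisor L) : principal D -> principal E -> principal (D + E).
Proof.
case=> f f0 Hf [g g0 Hg]; exists (f * g); rewrite ?mulf_neq0 // => P.
by rewrite coeffD Hf Hg place_valM.
Qed.

End Principal.

Section CubicDivisors.
Variables (K : finFieldType) (L : fieldExtType {fraction {poly K}}) (y : L).
Variables (B : {poly K}) (r : nat) (Q : 'I_r -> {poly K}).
Local Notation ev := (of_poly L).
Local Notation elt := (cubic_elt y).
Hypotheses (hB : ~~ (3 %| (size B).-1)%N) (hy : y ^+ 3 = ev B) (span : cubic_span y).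
Hypotheses (ch3 : 3%:R != 0 :> K) (sqf : squarefree_poly B).
Hypotheses (irrQ : forall i, irreducible_poly (Q i)) (BE : B = \prod_i Q i).
Implicit Types P : place L.

Let Q0 i : Q i != 0 := irredp_neq0 (irrQ i).

Let evQ0 i : ev (Q i) != 0. Proof. by rewrite of_poly_eq0. Qed.

Let sqf_irr q : irreducible_poly q -> q %| B -> ~~ (q ^+ 2 %| B).
Proof. by move=> [q1 _] _; apply: sqf; rewrite neq_ltn q1 orbT. Qed.

Let cofactor i : exists2 B', B = Q i * B' & ~~ (Q i %| B').
Proof.
exists (\prod_(j < r | j != i) Q j); first by rewrite BE (bigD1 i).
apply: contra (sqf_irr (irrQ i) _) => [H|]; rewrite BE (bigD1 i) //=.
  by rewrite expr2 dvdp_mul2l.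
exact: dvdp_mulIl.
Qed.

Let Q_ndvd i j : i != j -> ~~ (Q i %| Q j).
Proof.
move=> ij; apply/negP => Qij; move: (sqf_irr (irrQ i)).
rewrite BE (bigD1 i) //= dvdp_mulIl => /(_ isT)/negP; apply.
rewrite (bigD1 j) ?[j == _]eq_sym //= expr2 dvdp_mul2l //; exact: dvdp_mulr.
Qed.

Let ram_ex i := let: ex_intro2 B' BE nQB' := cofactor i in
  ramified_place hB hy span (irrQ i) BE nQB'.

Let Pram i : place L := projT1 (cid (ram_ex i)).

Let Pinf : place L := projT1 (cid (infinite_place hB hy span)).

Let PramP i : [/\ place_above (Pram i) (Q i), Pram i (ev (Q i)) = 3, Pram i y = 1,
    place_degree (Pram i) = (size (Q i)).-1 &
    forall P, place_above P (Q i) -> P = Pram i].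
Proof.
rewrite /Pram; case: cid => P /= [aP PQ Py Pres Puniq]; split=> //.
exact: place_degreeE (residue_basis_above (irrQ i) aP Pres).
Qed.

Let Pinf_poly p : p != 0 -> Pinf (ev p) = - ((size p).-1 * 3)%N%:Z.
Proof. by rewrite /Pinf; case: cid => P /= [+ _ _ _]; apply. Qed.

Let Pinf_uniq P : P (ev 'X) < 0 -> P = Pinf.
Proof. by rewrite /Pinf; case: cid => P' /= [_ _ _]; apply. Qed.

Let Pinf_degree : place_degree Pinf = 1%N.
Proof.
rewrite /Pinf; case: cid => P /= [_ _ Pres _].
apply: (@place_degreeE _ _ _ _ (fun _ : 'I_1 => 1)); split=> [_|f].
  by rewrite in_valuation_ringE /vge place_val1 lexx orbT.
rewrite in_valuation_ringE => /Pres[k fk]; exists (\row__ k); split=> [|a].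
  by rewrite in_maximal_idealE big_ord1 mxE mulr1.
rewrite in_maximal_idealE big_ord1 mulr1 => fa; apply/rowP => j; rewrite mxE ord1.
apply/eqP; rewrite -subr_eq0; apply/negPn/negP => ka.
have : vge P 1 (of_const L (k - a 0 0)).
  have -> : of_const L (k - a 0 0) = (f - of_const L (a 0 0)) - (f - of_const L k).
    by rewrite /of_const polyCB rmorphB; ring.
  exact: vgeB.
by rewrite vgeP ?place_val_const // /of_const of_poly_eq0 polyC_eq0.
Qed.

Let Pram_inj i j : Pram i = Pram j -> i = j.
Proof.
move=> E; apply/eqP/negPn/negP => ij; have [aP _ _ _ _] := PramP i.
have := place_val_above0 (irrQ i) aP (Q_ndvd ij).
by rewrite E; have [_ -> _ _ _] := PramP j.
Qed.

Let Pram_inf i : Pram i != Pinf.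
Proof.
apply/eqP => E; have [_ + _ _ _] := PramP i; rewrite E Pinf_poly //; lia.
Qed.

Let ram_divisor i : divisor L :=
  << Pram i >> - << ((size (Q i)).-1)%:Z *g Pinf >>.

Let coeff_ram P i : coeff P (ram_divisor i) =
  (Pram i == P)%:R - ((size (Q i)).-1)%:Z * (Pinf == P)%:R.
Proof. by rewrite /ram_divisor raddfB /= !coeffU mul1r. Qed.

Let place_val_Q P i : P (ev (Q i)) = 3 * coeff P (ram_divisor i).
Proof.
rewrite coeff_ram; have [aP PQ _ _ Puniq] := PramP i.
have [<-|nPi] := eqVneq (Pram i) P; first by rewrite eq_sym (negPf (Pram_inf i)) mulr0 PQ.
have [<-|nPinf] := eqVneq Pinf P; first by rewrite Pinf_poly // mulr1 sub0r mulrN mulrC PoszM.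
rewrite mulr0 subrr mulr0.
have PX : 0 <= P (ev 'X).
  by rewrite leNgt; apply: contra nPinf => /Pinf_uniq ->.
have := vge_poly (Q i) PX; rewrite vgeP // le_eqVlt => /orP[/eqP //|PQ0].
by case/eqP: nPi; rewrite (Puniq P).
Qed.

Let deg_ram i : divisor_degree (ram_divisor i) = 0.
Proof.
rewrite /ram_divisor divisor_degreeB /divisor_degree !liftU.
have [_ _ _ -> _] := PramP i.
by rewrite Pinf_degree scale1r; apply/eqP; rewrite subr_eq0 [_ *: _]mulr1.
Qed.

Let principal_ram3 i : principal (ram_divisor i *+ 3).
Proof.
by exists (ev (Q i)) => // P; rewrite coeffMn place_val_Q; ring.
Qed.

Let principal_ram_sum (a : 'I_r -> nat) :
  principal (\sum_i ram_divisor i *+ a i) -> forall i j, a i = a j %[mod 3].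
Proof.
case=> f f0 Hf.
have coeff_sum P : coeff P (\sum_i ram_divisor i *+ a i) = \sum_i coeff P (ram_divisor i) *+ a i.
  by rewrite raddf_sum; apply: eq_bigr => i _; rewrite raddfMn.
pose q := \prod_i Q i ^+ a i.
have q0 : q != 0 by apply/prodf_neq0 => i _; rewrite expf_neq0.
have evq0 : ev q != 0 by rewrite of_poly_eq0.
have Pq P : P (ev q) = P (f ^+ 3).
  have -> : P (ev q) = \sum_i P (ev (Q i)) *+ a i.
    rewrite /q rmorph_prod.
    suff [] : \prod_i ev (Q i ^+ a i) != 0 /\ P (\prod_i ev (Q i ^+ a i)) = \sum_i P (ev (Q i)) *+ a i by [].
    elim/big_rec2: _ => [|i s u _ [u0 <-]]; first by rewrite oner_neq0 place_val1.
    rewrite mulf_neq0 ?of_poly_eq0 ?expf_neq0 // place_valM ?of_poly_eq0 ?expf_neq0 //.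
    by rewrite rmorphXn place_valX -mulr_natr natz.
  rewrite place_valX -Hf coeff_sum mulr_suml; apply: eq_bigr => i _.
  by rewrite place_val_Q -mulrnAr mulrC.
have f30 : f ^+ 3 != 0 by rewrite expf_neq0.
have [k kE] : exists k, f ^+ 3 / ev q = of_const L k.
  apply: (constant_of_places hB hy span ch3 sqf_irr) => P.
  by rewrite vgeP ?mulf_neq0 ?invr_neq0 // place_valM ?invr_neq0 // place_valV Pq subrr.
have {kE} f3 : f ^+ 3 = ev (k%:P * q) by rewrite rmorphM /= -[ev k%:P]/(of_const L k) -kE divfK.
have [u [v [w [d [d0 fE]]]]] := span f.
have evd0 : ev d != 0 by rewrite of_poly_eq0.
have : elt u v w ^+ 3 = elt (d ^+ 3 * (k%:P * q)) 0 0.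
  by rewrite cubic_elt_poly rmorphM /= -f3 fE rmorphXn expr_div_n mulrC divfK ?expf_neq0.
rewrite exprS expr2 !(cubic_eltM hy) => /(cubic_elt_inj hB hy)[_ E1 E2].
have n3 : (3%:R : {poly K}) != 0 by rewrite -polyC1 -polyCMn polyC_eq0.
(* The cube of the numerator of [f] is a polynomial, so its coordinates at [y]
   and [y^2] are 0. *)
have E1' : u ^+ 2 * v + v ^+ 2 * w * B + u * w ^+ 2 * B = 0.
  by apply: (mulfI n3); rewrite mulr0 -E1; ring.
have E2' : u * v ^+ 2 + u ^+ 2 * w + v * w ^+ 2 * B = 0.
  by apply: (mulfI n3); rewrite mulr0 -E2; ring.
have [l [g fgE]] : exists l g, f = ev g * y ^+ l / ev d.
  rewrite fE /cubic_elt; case: (cubic_cube_coord hB E1' E2') => -[-> ->].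
  - by exists 0%N, u; rewrite !rmorph0; congr (_ / _); ring.
  - by exists 1%N, v; rewrite !rmorph0; congr (_ / _); ring.
  - by exists 2%N, w; rewrite !rmorph0; congr (_ / _); ring.
(* At [Pram i], the value of [f] is [a i], and those of polynomials are
   multiples of 3. *)
suff H i : a i = l %[mod 3] by move=> i j; rewrite !H.
have := Hf (Pram i); rewrite coeff_sum (bigD1 i) //= big1 => [|j ji]; last first.
  rewrite coeff_ram [Pinf == _]eq_sym (negPf (Pram_inf i)) mulr0 subr0.
  by case: eqP => [/Pram_inj E|_]; [rewrite E eqxx in ji|rewrite mul0rn].
rewrite addr0 coeff_ram eqxx [Pinf == _]eq_sym (negPf (Pram_inf i)) mulr0 subr0.
have [aP PQ Py _ _] := PramP i.
have [s gE] := place_val_above (irrQ i) aP g; have [t dE] := place_val_above (irrQ i) aP d.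
have y0 : y != 0 by apply: contra_eqN Py => /eqP ->; rewrite place_val0.
have g0 : ev g != 0 by apply: contraNneq f0 => g0; rewrite fgE g0 !mul0r.
rewrite fgE !place_valM ?mulf_neq0 ?invr_neq0 ?expf_neq0 // place_valV place_valX Py gE dE PQ.
rewrite -[1%:R *+ _]/((1%:R : int) *+ a i) natz.
by move: (a i) => m; clear; lia.
Qed.

(** The [D i] are the [P i - deg (Q i) * Pinf], where [P i] is the ramified
    place above [Q i]; three times [D i] is the divisor of [Q i]. *)
Lemma ramified_divisors : exists D : 'I_r -> divisor L,
  [/\ forall i, divisor_degree (D i) = 0, forall i, principal (D i *+ 3) &
      forall a : 'I_r -> nat, principal (\sum_i D i *+ a i) ->
        forall i j, a i = a j %[mod 3]].
Proof. by exists ram_divisor. Qed.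

End CubicDivisors.

Theorem corollary4p2 (Fq : finFieldType) (p : nat)
    (L : fieldExtType {fraction {poly Fq}}) (y : L)
    (B : {poly Fq}) (r : nat) (Q : 'I_r -> {poly Fq}) (h : nat)
    (hp : p \in [pchar Fq])
    (hcubic : \dim {:L} = 3%N)
    (hgen : <<1; y>>%VS = {:L}%VS)
    (hy : y ^+ 3 = of_poly L B)
    (hsqf : squarefree_poly B)
    (hQirr : forall i, irreducible_poly (Q i))
    (hQinj : injective Q)
    (hB : B = \prod_(i < r) Q i)
    (hdeg : ~~ (3 %| (size B).-1)%N)
    (hchar : ~~ (3 %| p)%N)
    (hr : (2 <= r)%N)
    (hh : is_class_number L h) :
  (3 ^ r.-1 %| h)%N.
Proof.
have ch3 : 3%:R != 0 :> Fq.
  rewrite -(dvdn_pcharf hp); apply: contra hchar.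
  by rewrite dvdn_prime2 ?(pcharf_prime hp) // => /eqP ->.
have span := cubic_span_gen hcubic hgen.
have [D [degD D3 D_indep]] := ramified_divisors hdeg hy span ch3 hsqf hQirr hB.
case: r hr Q hQirr hQinj hB D degD D3 D_indep => // r _ Q _ _ _ D degD D3 D_indep /=.
apply: (@dvdn_card_quotient _ (@principal _ L) (fun E => divisor_degree E = 0) 3 r h
  (fun j => D (fintype.lift ord0 j))) => //.
- exact: principal0.
- exact: principalN.
- exact: principalD.
- by move=> E F E0 F0; rewrite divisor_degreeD E0 F0.
- exact: divisor_degree0.
(* Modulo 3, a relation between all the [D i] has equal coefficients; and [D ord0]
   is given the coefficient 0. *)
move=> a Na j.
pose a' i := if unlift ord0 i is Some k then a k else 0%N.
have : principal (\sum_i D i *+ a' i).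
  rewrite big_ord_recl /a' unlift_none mulr0n add0r.
  by under eq_bigr => k _ do rewrite liftK.
by move=> /D_indep/(_ (fintype.lift ord0 j) ord0); rewrite /a' liftK unlift_none /dvdn => ->.
Qed.
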